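(* The set $C(\lambda)_{smix}$ of strongly mixing maps in $C(\lambda)$ is dense in the metric space $(C(\lambda),\rho)$.
   Context: $\lambda$ is the Lebesgue measure on $[0,1]$, $\mathcal B$ the Borel $\sigma$-algebra of $[0,1]$. $C(\lambda)$ is the set of all continuous maps $f\colon[0,1]\to[0,1]$ with $\lambda(A)=\lambda(f^{-1}(A))$ for all $A\in\mathcal B$, equipped with the complete metric $\rho(f,g)=\sup_{x\in[0,1]}|f(x)-g(x)|$. A map $f\in C(\lambda)$ is strongly mixing if for every $A,B\in\mathcal B$, $\lim_{n\to\infty}\lambda(f^{-n}(A)\cap B)=\lambda(A)\lambda(B)$. *)

(* Defs.v *)
From HB Require Import structures.
From mathcomp Require Import all_boot all_order all_algebra.
From mathcomp Require Import all_classical all_reals all_analysis.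
From mathcomp Require Import lra.
Set Implicit Arguments.
Unset Strict Implicit.
Unset Printing Implicit Defensive.
Import Order.TTheory GRing.Theory Num.Theory.
Import numFieldNormedType.Exports.
Local Open Scope classical_set_scope.
Local Open Scope ring_scope.

(* The subtype of R, with the library's topology induced by the inclusion. *)
Notation I01 R := (set_type `[(0 : R%type), (1 : R%type)]%classic).

Definition borel01 (R : realType) : set (set (I01 R)) :=
  <<s [set U : set (I01 R) | open U] >>.

Definition lambda01 (R : realType) (A : set (I01 R)) : \bar R :=
  lebesgue_measure (set_val @` A).

Record Clambda (R : realType) := MkClambda {
  Clambda_fun :> I01 R -> I01 R ;
  Clambda_continuous : continuous Clambda_fun ;
  Clambda_preserving : forall A : set (I01 R), borel01 A ->
    lambda01 A = lambda01 (Clambda_fun @^-1` A) }.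

Definition rho (R : realType) (f g : Clambda R) : R :=
  sup (range (fun x : I01 R => `|set_val (f x) - set_val (g x)|)).

Section metric.
Context {R : realType}.
Implicit Types f g h : Clambda R.

Lemma Clambda_ext f g : (forall x, f x = g x) -> f = g.
Proof.
case: f g => f fc fp [g gc gp] /= /funext fg; subst g.
by rewrite (Prop_irrelevance fc gc) (Prop_irrelevance fp gp).
Qed.

Lemma I01_bounds (x : I01 R) : 0 <= set_val x <= 1.
Proof. by case: x => x; rewrite set_valE /= => /set_mem; rewrite /= in_itv. Qed.

Lemma rho_has_sup f g :
  has_sup (range (fun x : I01 R => `|set_val (f x) - set_val (g x)|)).
Proof.
have I0 : (0 : R) \in `[(0 : R), (1 : R)]%classic.
  by apply/mem_set; rewrite /= in_itv /= lexx ler01.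
split; first by eexists; exists (exist _ 0 I0).
exists 1 => _ [x _ <-].
have /andP[f0 f1] := I01_bounds (f x); have /andP[g0 g1] := I01_bounds (g x).
by rewrite ler_norml; apply/andP; split; lra.
Qed.

Lemma rho_ub f g x : `|set_val (f x) - set_val (g x)| <= rho f g.
Proof. by apply: ub_le_sup; [case: (rho_has_sup f g)|exists x]. Qed.

Lemma rho_le f g e :
  (forall x, `|set_val (f x) - set_val (g x)| <= e) -> rho f g <= e.
Proof.
by move=> fge; apply: ge_sup; [case: (rho_has_sup f g)|move=> _ [x _ <-]].
Qed.

Lemma rhoxx f : rho f f = 0.
Proof.
have [[_ [x _ _]] _] := rho_has_sup f f.
apply/le_anti/andP; split; first by apply: rho_le => y; rewrite subrr normr0.
by apply: le_trans (rho_ub f f x).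
Qed.

Lemma rho_positivity f g : rho f g = 0 -> f = g.
Proof.
move=> fg0; apply: Clambda_ext => x; apply/val_inj/eqP.
rewrite -subr_eq0 -normr_le0.
by apply: le_trans (rho_ub f g x) _; rewrite fg0.
Qed.

Lemma rho_sym f g : rho f g = rho g f.
Proof.
by apply/le_anti/andP; split; apply: rho_le => x; rewrite distrC; exact: rho_ub.
Qed.

Lemma rho_triangle g f h : rho f h <= rho f g + rho g h.
Proof.
apply: rho_le => x; apply: le_trans (ler_distD (set_val (g x)) _ _) _.
by apply: lerD; exact: rho_ub.
Qed.

End metric.

HB.instance Definition _ (R : realType) := gen_eqMixin (Clambda R).
HB.instance Definition _ (R : realType) := gen_choiceMixin (Clambda R).
HB.instance Definition _ (R : realType) :=
  @isMetric.Build R (Clambda R) (@rho R)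
    rhoxx rho_positivity rho_sym rho_triangle.

Definition strongly_mixing (R : realType) (f : Clambda R) : Prop :=
  forall A B : set (I01 R), borel01 A -> borel01 B ->
    lambda01 ((iter n f @^-1` A) `&` B) @[n --> \oo]
      --> (lambda01 A * lambda01 B)%E.

Definition Clambda_smix (R : realType) : set (Clambda R) :=
  [set f | strongly_mixing f].
Arguments Clambda_smix : clear implicits.

(* Main.v *)
Require Import Defs.
From mathcomp Require Import all_boot all_order all_algebra.
From mathcomp Require Import all_classical all_reals all_analysis.
From mathcomp Require Import measurable_realfun.
From mathcomp Require Import zify ring lra.
Set Implicit Arguments.
Unset Strict Implicit.
Unset Printing Implicit Defensive.
Import Order.TTheory GRing.Theory Num.Theory.
Import numFieldNormedType.Exports.
Local Open Scope classical_set_scope.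
Local Open Scope ring_scope.

(** Let [f] be a continuous map of [0, 1] that preserves Lebesgue measure. The
    strongly mixing map close to [f] is a piecewise affine Markov map built from the
    statistics of [f] on a fine grid.

    Cut [0, 1] into [n] equal cells, and let [frequency i j] be the share of the cell
    [i] sent by [f] into the cell [j]. Invariance of the measure makes this matrix
    doubly stochastic. Averaging each row with its two neighbours gives a doubly
    stochastic matrix [P] in which neighbouring rows share a positive column
    ([smoothed_adj]), while by the intermediate value theorem the support of each row
    is still an interval ([smoothed_interval]). Hence on the cell [i] a continuous
    path can run through exactly the cells [j] with [0 < P i j], spending time
    [P i j / n] in the cell [j] and crossing it each time affinely from end to end;
    the shared columns allow the paths of neighbouring cells to be joined. The
    resulting map [g] pushes the measure of the cell [i] to the measure with density
    [P i j] on the cell [j] ([walk_transfer]). As the columns sum to 1, [g] preserves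
    Lebesgue measure, and uniform continuity of [f] makes it close to [f].

    Mixing of [g] has two parts. For a Borel set [A] the vector of the masses of
    [g^-n A] in the cells is [P^n] applied to that of [A], so it suffices that [P^n v]
    tends to a constant vector. The sum of squares of [P^n v] decreases, and the
    decrease at one step is the sum of the [P i j (v j - (P v) i)^2]; these
    tend to zero, so that coordinates connected by positive entries merge
    ([doubly_stochastic_cvg]). This gives mixing of [A] with the cells. For an
    interval [0, t], the affine branches express the mass of [g^-(n+1) A] in [0, t]
    through cell masses and the mass of [g^-n A] in some other interval [0, t'], with a
    factor bounded by a constant less than 1; iterating this kills the error
    ([cum_cvg_geometric]). A Dynkin argument passes from intervals to
    Borel sets ([markov_mixes]). *)

(** * The cumulative mass of a set *)

Section cumulative.
Context {R : realType}.
Implicit Types (A B : set R) (a b t : R).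
Local Notation mu := (@lebesgue_measure R).
Local Notation measurable := (@measurable _ (measurableTypeR R)).

(** All measures are read off from this real-valued function of [t]: a set of
    measure zero at the endpoint does not matter, half-open intervals add up
    without overlaps, and differences [cum A b - cum A a] carry a sign. *)
Definition cum A t : R := fine (mu (A `&` `]0, t])).

Lemma mu_itv_fin A a b : measurable A -> mu (A `&` `]a, b]) \is a fin_num.
Proof.
move=> mA; rewrite ge0_fin_numE ?measure_ge0//.
apply: (@le_lt_trans _ _ (mu `]a, b])).
  by apply: le_measure; rewrite ?inE; 
    [exact: measurableI|exact: measurable_itv|move=> x []].
by rewrite lebesgue_measure_itv/=; case: ifP => _; rewrite ?ltry// -EFinB ltry.
Qed.

Lemma cumB A a b : measurable A -> 0 <= a <= b ->
  cum A b - cum A a = fine (mu (A `&` `]a, b])).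
Proof.
move=> mA /andP[a0 ab]; rewrite /cum.
have -> : A `&` `]0, b] = (A `&` `]0, a]) `|` (A `&` `]a, b]).
  rewrite -setIUr; congr (_ `&` _); apply/esym/seteqP.
  split=> x /=; rewrite !in_itv/=; first by lra.
  move=> /andP[x0 xb].
  by case: (leP x a) => xa; [left|right]; rewrite ?x0 ?xa.
rewrite measureU; first last.
- apply/seteqP; split=> x //= -[[_]] + [_]; rewrite !in_itv/=; lra.
- exact: measurableI.
- exact: measurableI.
by rewrite fineD ?mu_itv_fin// addrC addKr.
Qed.

Lemma cumT t : 0 <= t -> cum setT t = t.
Proof.
rewrite /cum setTI lebesgue_measure_itv/= lte_fin le_eqVlt => /predU1P[<-|t0].
  by rewrite ltxx.
by rewrite t0 oppr0 adde0.
Qed.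

Lemma cum0 A : cum A 0 = 0.
Proof. by rewrite /cum set_itvoc0 setI0 measure0. Qed.

Lemma cum_ge0 A t : 0 <= cum A t.
Proof. by rewrite fine_ge0. Qed.

Lemma cum_mono A a b : measurable A -> 0 <= a <= b -> cum A a <= cum A b.
Proof. by move=> mA ab; rewrite -subr_ge0 cumB// fine_ge0. Qed.

End cumulative.

(** * Lebesgue measure along an affine branch *)

Section affine.
Context {R : realType}.
Implicit Types (A B C : set R) (a b t s c : R).
Local Notation mu := (@lebesgue_measure R).
Local Notation measurable := (@measurable _ (measurableTypeR R)).

Lemma lebesgue_measure_off_null A B C :
    measurable A -> measurable B -> measurable C -> mu C = 0%E ->
  A `<=` B `|` C -> B `<=` A `|` C -> mu A = mu B.
Proof.
move=> mA mB mC C0 AB BA.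
rewrite -(measureU0 mA mC C0) -(measureU0 mB mC C0); congr (mu _).
by apply/seteqP; split => x [|Cx]; [exact: AB|right|exact: BA|right].
Qed.

Lemma measurable_preim (g : R -> R) A : continuous g -> measurable A ->
  measurable (g @^-1` A).
Proof.
move=> /continuous_measurable_fun mg mA.
by rewrite -[X in measurable X]setTI; exact: mg.
Qed.

Lemma affine_continuous s c : continuous (fun x : R => s * x + c).
Proof.
by move=> x; apply: cvgD; [apply: cvgM; [exact: cvg_cst|exact: cvg_id]|exact: cvg_cst].
Qed.

Lemma lebesgue_measure_preimage_affine_pos s c A : 0 < s -> measurable A ->
  mu ((fun x => s * x + c) @^-1` A) = (s^-1%:E * mu A)%E.
Proof.
move=> s0 mA.
pose f : measurableTypeR R -> measurableTypeR R := fun x => s * x + c.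
have mf : measurable_fun setT f.
  exact: (continuous_measurable_fun (@affine_continuous s c)).
pose m := pushforward (mscale (NngNum (ltW s0)) mu) f.
suff -> : mu A = m A.
  by rewrite /m /pushforward /mscale /= muleA -EFinM mulVf ?gt_eqF// mul1e.
apply: lebesgue_measure_unique => //= _ [[a b]] _ <-.
rewrite /m /pushforward /mscale /=.
rewrite (_ : f @^-1` _ = `](a - c) / s, (b - c) / s]%classic); last first.
  apply/seteqP; split => x /=; rewrite !in_itv/= /f ltr_pdivrMr// ler_pdivlMr//;
    rewrite ![x * s]mulrC; lra.
rewrite !lebesgue_measure_itv/= !lte_fin ltr_pM2r ?invr_gt0// ltrD2r.
case: ifP => _; last by rewrite mule0.
by rewrite -!EFinB -EFinM; congr EFin; field; rewrite gt_eqF.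
Qed.

Lemma lebesgue_measure_preimage_affine s c A : s != 0 -> measurable A ->
  mu ((fun x => s * x + c) @^-1` A) = (`|s|^-1%:E * mu A)%E.
Proof.
move=> sN0 mA; have [s0|s0|s0] := ltgtP s 0; last by rewrite s0 eqxx in sN0.
  rewrite -(@lebesgue_measure_preimage_affine_pos `|s| c) ?normr_gt0//.
  rewrite -[RHS](lebesgue_measureN (measurable_preim (@affine_continuous _ _) mA)).
  rewrite /pushforward; congr (mu _); apply/funext => x /=.
  by rewrite ltr0_norm// mulrNN.
by rewrite gtr0_norm// lebesgue_measure_preimage_affine_pos.
Qed.

(** The signed difference [cum A (g b) - cum A (g a)] lets one formula serve both
    orientations: for a decreasing branch the sign of the slope and the sign of
    the difference cancel. The image of the half-open interval is then closed on
    the other side, which only moves a null set. *)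
Lemma cum_affine (g : R -> R) A a b s : continuous g -> measurable A ->
  0 <= a <= b -> s != 0 -> (forall t, a <= t <= b -> g t = g a + s * (t - a)) ->
  0 <= g a -> 0 <= g b ->
  cum (g @^-1` A) b - cum (g @^-1` A) a = s^-1 * (cum A (g b) - cum A (g a)).
Proof.
move=> cg mA /andP[a0 ab] sN0 gE ga0 gb0.
have mgA := measurable_preim cg mA.
rewrite cumB ?a0 ?ab//.
have gb : g b = g a + s * (b - a) by apply: gE; rewrite ab lexx.
pose h := fun x => s * x + (g a - s * a).
have gh x : x \in `]a, b] -> g x = h x.
  by rewrite in_itv/= => /andP[ax xb]; rewrite gE ?(ltW ax)// /h; ring.
have [s0|s0|s0] := ltgtP s 0; last by rewrite s0 eqxx in sN0.
- have gba : g b <= g a by rewrite gb; nra.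
  rewrite -opprB cumB ?gb0 ?gba//.
  have -> : g @^-1` A `&` `]a, b] = h @^-1` (A `&` `[g b, g a[).
    apply/seteqP; split=> x /= [].
      move=> Ax xab; rewrite -gh//; split=> //.
      by move: xab; rewrite /= !in_itv/= => xab; rewrite (gE x) ?gb; nra.
    rewrite /h !in_itv/= gb => Ax xab.
    have xI : a < x <= b by apply/andP; split; nra.
    by split=> //; rewrite gh// in_itv.
  rewrite lebesgue_measure_preimage_affine//; last exact: measurableI.
  rewrite (@lebesgue_measure_off_null _ (A `&` `]g b, g a]) ([set g a] `|` [set g b])).
  + rewrite fineM ?mu_itv_fin//= ltr0_norm// invrN; ring.
  + exact: measurableI.
  + exact: measurableI.
  + by apply: measurableU; exact: measurable_set1. 
  + rewrite (@measureU0 _ (measurableTypeR R) _ mu);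
      try exact: measurable_set1; exact: lebesgue_measure_set1.
  + move=> x [Ax]; rewrite /= !in_itv/= => /andP[].
    rewrite le_eqVlt => /predU1P[<-|bx xa]; first by right; right.
    by left; rewrite bx ltW.
  + move=> x [Ax]; rewrite /= !in_itv/= => /andP[bx].
    rewrite le_eqVlt => /predU1P[->|xa]; first by right; left.
    by left; rewrite xa ltW.
- have gab : g a <= g b by rewrite gb; nra.
  rewrite cumB ?ga0 ?gab//.
  have -> : g @^-1` A `&` `]a, b] = h @^-1` (A `&` `]g a, g b]).
    apply/seteqP; split=> x /= [].
      move=> Ax xab; rewrite -gh//; split=> //.
      by move: xab; rewrite /= !in_itv/= => xab; rewrite (gE x) ?gb; nra.
    rewrite /h !in_itv/= gb => Ax xab.
    have xI : a < x <= b by apply/andP; split; nra.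
    by split=> //; rewrite gh// in_itv.
  rewrite lebesgue_measure_preimage_affine//; last exact: measurableI.
  by rewrite fineM ?mu_itv_fin//= gtr0_norm.
Qed.

End affine.

(** * Powers of a doubly stochastic matrix *)

Lemma cvg_sumr {R : realType} {T I : Type} {F : set_system T} {FF : Filter F}
    (r : seq I) (f : I -> T -> R) (l : I -> R) :
  (forall i, f i x @[x --> F] --> l i) ->
  \sum_(i <- r) f i x @[x --> F] --> \sum_(i <- r) l i.
Proof.
move=> fl; elim: r => [|i r IHr].
  by rewrite big_nil; under eq_fun do rewrite big_nil; exact: cvg_cst.
by rewrite big_cons; under eq_fun do rewrite big_cons; exact: cvgD.
Qed.

Section doubly_stochastic.
Context {R : realType} {N : nat}.
Variables (P : 'I_N.+1 -> 'I_N.+1 -> R) (v : nat -> 'I_N.+1 -> R).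
Hypothesis P_ge0 : forall i j, 0 <= P i j.
Hypothesis P_row : forall i, \sum_j P i j = 1.
Hypothesis P_col : forall j, \sum_i P i j = 1.
Hypothesis P_adj : forall i i' : 'I_N.+1, i' = i.+1 :> nat ->
  exists2 j, 0 < P i j & 0 < P i' j.
Hypothesis vS : forall n i, v n.+1 i = \sum_j P i j * v n j.

Let energy n := \sum_j v n j ^+ 2.

(** Row by row this is the identity [E X^2 - (E X)^2 = E (X - E X)^2] for the
    probability [P i]; the column sums turn the sum of the second moments into
    the energy of [v n]. *)
Lemma energy_drop n : energy n - energy n.+1 =
  \sum_i \sum_j P i j * (v n j - v n.+1 i) ^+ 2.
Proof.
have -> : energy n = \sum_i \sum_j P i j * v n j ^+ 2.
  rewrite exchange_big; apply: eq_bigr => j _ /=.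
  by rewrite -mulr_suml P_col mul1r.
rewrite -sumrB; apply: eq_bigr => i _; apply/esym.
transitivity (\sum_j (P i j * v n j ^+ 2 -
    (2 * v n.+1 i) * (P i j * v n j) + P i j * v n.+1 i ^+ 2)).
  by apply: eq_bigr => j _; ring.
rewrite big_split sumrB /= -mulr_sumr -vS -mulr_suml P_row; ring.
Qed.

Lemma energy_drop_ge0 n : 0 <= energy n - energy n.+1.
Proof.
rewrite energy_drop; apply: sumr_ge0 => i _; apply: sumr_ge0 => j _.
by rewrite mulr_ge0 ?sqr_ge0.
Qed.

Lemma energy_drop_cvg0 : energy n - energy n.+1 @[n --> \oo] --> 0.
Proof.
have cvg_e : cvgn energy.
  apply: nonincreasing_is_cvgn.
    by apply/nonincreasing_seqP => n; rewrite -subr_ge0 energy_drop_ge0.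
  by exists 0 => _ [n _ <-]; apply: sumr_ge0 => j _; rewrite sqr_ge0.
rewrite -(subrr (limn energy)); apply: cvgB => //.
by rewrite (cvg_shiftS energy).
Qed.

(** The energy decreases and is bounded below, so its drops tend to zero, and each
    drop dominates the term of every positive entry. *)
Lemma positive_entry_cvg0 i j : 0 < P i j ->
  v n j - v n.+1 i @[n --> \oo] --> 0.
Proof.
move=> Pij; apply/cvgr0Pnorm_lt => e e0.
have /cvgr0Pnorm_lt/(_ (P i j * e ^+ 2)) := energy_drop_cvg0.
move=> /(_ (mulr_gt0 Pij (exprn_gt0 2 e0))); apply: filterS => n.
rewrite ger0_norm ?energy_drop_ge0// => drop_lt.
rewrite -(@ltr_pXn2r _ 2) ?nnegrE ?(ltW e0)// -normrX ger0_norm ?sqr_ge0//.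
rewrite -(ltr_pM2l Pij); apply: le_lt_trans drop_lt.
rewrite energy_drop (bigD1 i)//= (bigD1 j)//= -addrA lerDl addr_ge0//.
  by apply: sumr_ge0 => k _; rewrite mulr_ge0 ?sqr_ge0.
apply: sumr_ge0 => k _; apply: sumr_ge0 => l _.
by rewrite mulr_ge0 ?sqr_ge0.
Qed.

(** Neighbouring rows have a positive entry in a common column, so both new
    coordinates approach the same old one. *)
Lemma coordinates_merge i : v n i - v n ord0 @[n --> \oo] --> 0.
Proof.
case: i => m; elim: m => [|m IHm] mN.
  have -> : Ordinal mN = ord0 by apply: val_inj.
  by under eq_fun do rewrite subrr; exact: cvg_cst.
have mN' : (m < N.+1)%N by exact: ltnW.
have [j Pmj Pm'j] := @P_adj (Ordinal mN') (Ordinal mN) erefl.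
have stepS : v n.+1 (Ordinal mN) - v n.+1 (Ordinal mN') @[n --> \oo] --> (0 : R).
  have -> : (fun n => v n.+1 (Ordinal mN) - v n.+1 (Ordinal mN')) =
      (fun n => (v n j - v n.+1 (Ordinal mN')) - (v n j - v n.+1 (Ordinal mN))).
    by apply/funext => n; ring.
  by rewrite -[X in _ --> X](subrr 0); apply: cvgB; exact: positive_entry_cvg0.
have step : v n (Ordinal mN) - v n (Ordinal mN') @[n --> \oo] --> (0 : R).
  by move: stepS; rewrite (cvg_shiftS (fun n => v n (Ordinal mN) - v n (Ordinal mN'))).
have -> : (fun n => v n (Ordinal mN) - v n ord0) =
    (fun n => (v n (Ordinal mN) - v n (Ordinal mN')) + (v n (Ordinal mN') - v n ord0)).
  by apply/funext => n; ring.
by rewrite -[X in _ --> X](addr0 0); apply: cvgD (step) (IHm mN').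
Qed.

Lemma coordinate_sum n : \sum_i v n i = \sum_i v 0 i.
Proof.
elim: n => // n <-; under eq_bigr do rewrite vS.
rewrite exchange_big; apply: eq_bigr => j _ /=.
by rewrite -mulr_suml P_col mul1r.
Qed.

(** All coordinates merge while their sum is conserved, so they tend to its mean.
    Sharing columns between neighbouring rows replaces primitivity of [P]. *)
Lemma doubly_stochastic_cvg i :
  v n i @[n --> \oo] --> (\sum_j v 0 j) / N.+1%:R.
Proof.
have N0 : N.+1%:R != 0 :> R by rewrite pnatr_eq0.
have vE n : v n i = (\sum_j v 0 j) / N.+1%:R +
    (\sum_j ((v n i - v n ord0) - (v n j - v n ord0))) / N.+1%:R.
  rewrite -(coordinate_sum n) -mulrDl -big_split/=.
  rewrite (eq_bigr (fun=> v n i)); last by move=> j _; ring.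
  by rewrite sumr_const card_ord -[_ *+ _]mulr_natr mulfK.
have -> : v^~ i = (fun n => (\sum_j v 0 j) / N.+1%:R +
    (\sum_j ((v n i - v n ord0) - (v n j - v n ord0))) / N.+1%:R).
  by apply/funext.
rewrite -[X in _ --> X]addr0; apply: cvgD; first exact: cvg_cst.
rewrite -[X in _ --> X](mul0r N.+1%:R^-1); apply: cvgM; last exact: cvg_cst.
have sum0 : \sum_(j < N.+1) (0 - 0) = 0 :> R by rewrite subrr big1.
rewrite -[X in _ --> X]sum0.
by apply: cvg_sumr => j; apply: cvgB; exact: coordinates_merge.
Qed.

End doubly_stochastic.

Section cumulative_algebra.
Context {R : realType}.
Implicit Types (A B : set R) (t : R).
Local Notation mu := (@lebesgue_measure R).
Local Notation measurable := (@measurable _ (measurableTypeR R)).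

Lemma cumU A B t : measurable A -> measurable B -> A `&` B = set0 ->
  cum (A `|` B) t = cum A t + cum B t.
Proof.
move=> mA mB AB0; rewrite /cum setIUl measureU.
- by rewrite fineD ?mu_itv_fin.
- exact: measurableI.
- exact: measurableI.
- by rewrite setIACA setIid AB0 set0I.
Qed.

Lemma cumD A B t : measurable A -> measurable B ->
  cum (A `\` B) t = cum A t - cum (A `&` B) t.
Proof.
move=> mA mB; apply/eqP; rewrite eq_sym subr_eq; apply/eqP.
rewrite -cumU.
- by rewrite setUC setUIDK.
- exact: measurableD.
- exact: measurableI.
- by rewrite setDE setIACA setICl setI0.
Qed.

Lemma cum_le A B t : measurable A -> measurable B -> A `<=` B ->
  cum A t <= cum B t.
Proof.
move=> mA mB AB; rewrite -[in leLHS](setIidr AB) -subr_ge0 -cumD//.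
exact: cum_ge0.
Qed.

Lemma cum_le_id A t : measurable A -> 0 <= t -> cum A t <= t.
Proof. by move=> mA t0; rewrite -{2}(cumT t0) cum_le. Qed.

End cumulative_algebra.

(** * Mixing of a Markov map with affine branches *)

Section markov_mixing.
Context {R : realType} {N : nat}.
Local Notation mu := (@lebesgue_measure R).
Local Notation measurable := (@measurable _ (measurableTypeR R)).

Definition grid (j : nat) : R := j%:R / N.+1%:R.
Definition mass (A : set R) (j : nat) : R := cum A (grid j.+1) - cum A (grid j).

Lemma grid0 : grid 0 = 0. Proof. by rewrite /grid mul0r. Qed.

Lemma gridN : grid N.+1 = 1. Proof. by rewrite /grid divff// pnatr_eq0. Qed.

Lemma gridS j : grid j.+1 = grid j + N.+1%:R^-1.
Proof. by rewrite /grid -natr1 mulrDl mul1r. Qed.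

Lemma grid_ge0 j : 0 <= grid j.
Proof. by rewrite /grid divr_ge0. Qed.

Lemma ler_grid i j : (grid i <= grid j) = (i <= j)%N.
Proof. by rewrite /grid ler_pM2r ?invr_gt0 ?ltr0n// ler_nat. Qed.

Lemma ltr_grid i j : (grid i < grid j) = (i < j)%N.
Proof. by rewrite /grid ltr_pM2r ?invr_gt0 ?ltr0n// ltr_nat. Qed.

Lemma grid_le1 j : (j <= N.+1)%N -> grid j <= 1.
Proof. by rewrite -gridN ler_grid. Qed.

Lemma cum_grid A k : cum A (grid k) = \sum_(j < k) mass A j.
Proof.
elim: k => [|k IHk]; first by rewrite big_ord0 grid0 cum0.
by rewrite big_ord_recr/= -IHk /mass addrC subrK.
Qed.

Lemma sum_mass A : \sum_(j < N.+1) mass A j = cum A 1.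
Proof. by rewrite -cum_grid gridN. Qed.

Lemma massT j : mass setT j = N.+1%:R^-1.
Proof. by rewrite /mass !cumT ?grid_ge0// gridS addrC addKr. Qed.

Variables (g : R -> R) (P : 'I_N.+1 -> 'I_N.+1 -> R) (c0 : R).
Hypothesis g_cont : continuous g.
Hypothesis P_ge0 : forall i j, 0 <= P i j.
Hypothesis P_row : forall i, \sum_j P i j = 1.
Hypothesis P_col : forall j, \sum_i P i j = 1.
Hypothesis P_adj : forall i i' : 'I_N.+1, i' = i.+1 :> nat ->
  exists2 j, 0 < P i j & 0 < P i' j.
Hypothesis transfer : forall (A : set R) (i : 'I_N.+1), measurable A ->
  mass (g @^-1` A) i = \sum_j P i j * mass A j.
Hypothesis c0_ge0 : 0 <= c0.
Hypothesis c0_lt1 : c0 < 1.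
(* The branches of [g] are affine, so a time [t] inside a branch is mapped to
   a point [t'], and the mass of [0, t] in a preimage is that of the full branches
   before it, which are controlled by cell masses, plus a multiple of the mass of
   [0, t']. The factor [c] is the inverse slope. *)
Hypothesis contract : forall t : R, 0 <= t <= 1 ->
  exists q : 'I_N.+1 -> R, exists c t' : R, [/\ 0 <= t' <= 1, `|c| <= c0 &
    forall A : set R, measurable A ->
      cum (g @^-1` A) t = \sum_j q j * mass A j + c * cum A t'].

Implicit Types (A B : set R) (t : R).

Lemma iter_preimageS A n :
  iter n.+1 g @^-1` A = g @^-1` (iter n g @^-1` A).
Proof. by apply/funext => x; rewrite /preimage/= -iterS iterSr. Qed.

Lemma measurable_iter A n : measurable A -> measurable (iter n g @^-1` A).
Proof.
move=> mA; elim: n => // n IHn.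
by rewrite iter_preimageS; exact: measurable_preim.
Qed.

Lemma cum1_preimage A : measurable A -> cum (g @^-1` A) 1 = cum A 1.
Proof.
move=> mA; rewrite -!sum_mass (eq_bigr _ (fun i _ => transfer i mA)).
rewrite exchange_big; apply: eq_bigr => j _ /=.
by rewrite -mulr_suml P_col mul1r.
Qed.

Lemma cum1_iter A n : measurable A -> cum (iter n g @^-1` A) 1 = cum A 1.
Proof.
move=> mA; elim: n => // n IHn.
by rewrite iter_preimageS cum1_preimage//; exact: measurable_iter.
Qed.

Lemma mass_cvg A (i : 'I_N.+1) : measurable A ->
  mass (iter n g @^-1` A) i @[n --> \oo] --> cum A 1 / N.+1%:R.
Proof.
move=> mA; rewrite -sum_mass.
apply: (@doubly_stochastic_cvg _ _ P
  (fun n (i : 'I_N.+1) => mass (iter n g @^-1` A) i)) => // n k.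
by rewrite iter_preimageS transfer//; exact: measurable_iter.
Qed.

(** The error [cum (iter n g @^-1` A) t - t * cum A 1] at step [n.+1] is a combination
    of cell errors, which vanish in the limit, plus [c] times the error at another
    point at step [n]. The error is at most 1, and each use of this relation
    multiplies the bound by [c0], whatever the points are. *)
Lemma cum_cvg_geometric A m : measurable A ->
  forall t e : R, 0 <= t <= 1 -> 0 < e ->
  \forall n \near \oo, `|cum (iter n g @^-1` A) t - t * cum A 1| <= c0 ^+ m + e.
Proof.
move=> mA; elim: m => [|m IHm] t e t01 e0.
  apply: nearW => n; have mAn := measurable_iter n mA.
  have [t0 t1] := andP t01.
  have h1 := cum_ge0 (iter n g @^-1` A) t; have h2 := cum_le_id mAn t0.
  have h3 := cum_ge0 A 1; have h4 := cum_le_id mA (@ler01 R).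
  by rewrite expr0 ler_norml; apply/andP; split; nra.
have [q [c [t' [t'01 cc0 Ct]]]] := contract t01.
have tE : t = \sum_j q j / N.+1%:R + c * t'.
  have [t0 t1] := andP t01; have [t'0 t'1] := andP t'01.
  rewrite -{1}(cumT t0) -{1}(cumT t'0) -[in LHS](preimage_setT g) Ct//.
  by congr (_ + _); apply: eq_bigr => j _; rewrite massT.
have e20 : 0 < e / 2 by rewrite divr_gt0.
have q0 : \sum_j q j * (mass (iter n g @^-1` A) j - cum A 1 / N.+1%:R)
    @[n --> \oo] --> (0 : R).
  have sum0 : \sum_j q j * (cum A 1 / N.+1%:R - cum A 1 / N.+1%:R) = 0.
    by rewrite big1// => j _; rewrite subrr mulr0.
  rewrite -[X in _ --> X]sum0; apply: cvg_sumr => j; apply: cvgM.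
    exact: cvg_cst.
  by apply: cvgB; [exact: mass_cvg|exact: cvg_cst].
have step : \forall n \near \oo,
    `|cum (iter n.+1 g @^-1` A) t - t * cum A 1| <= c0 ^+ m.+1 + e.
  near=> n.
  rewrite iter_preimageS Ct; last exact: measurable_iter.
  rewrite {1}tE mulrDl mulr_suml [X in `|X|](_ : _ =
    \sum_j q j * (mass (iter n g @^-1` A) j - cum A 1 / N.+1%:R) +
    c * (cum (iter n g @^-1` A) t' - t' * cum A 1)); last first.
    rewrite opprD addrACA -sumrB; congr (_ + _); last by ring.
    by apply: eq_bigr => j _; ring.
  rewrite (le_trans (ler_normD _ _))// normrM exprS.
  have -> : e = e / 2 + e / 2 by rewrite -splitr.
  rewrite [leLHS]addrC addrA lerD//.
    have : `|cum (iter n g @^-1` A) t' - t' * cum A 1| <= c0 ^+ m + e / 2.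
      by near: n; exact: IHm.
    move=> /(ler_pM (normr_ge0 _) (normr_ge0 _) cc0)/le_trans; apply.
    by rewrite mulrDr lerD2l ler_piMl// ltW.
  by apply/ltW; near: n; move/cvgr0Pnorm_lt : q0; exact.
have [M _ HM] := step.
by exists M.+1 => // -[//|n] /= Mn; exact: HM.
Unshelve. all: by end_near. Qed.

Lemma cum_cvg A t : measurable A -> 0 <= t <= 1 ->
  cum (iter n g @^-1` A) t @[n --> \oo] --> t * cum A 1.
Proof.
move=> mA t01; apply/cvgrPdistC_le => e e0.
have e20 : 0 < e / 2 by rewrite divr_gt0.
have c0n : `|c0| < 1 by rewrite ger0_norm.
have /cvgr0Pnorm_lt/(_ _ e20)[m _ /(_ m (leqnn m))] := cvg_expr c0n.
rewrite ger0_norm ?exprn_ge0// => cm.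
apply: filterS (cum_cvg_geometric m mA t01 e20) => n /le_trans; apply.
by rewrite [leRHS]splitr lerD2r ltW.
Qed.

Definition mixes A B := 
  cum (iter n g @^-1` A `&` B) 1 @[n --> \oo] --> cum A 1 * cum B 1.

Lemma mixes_oc A a b : measurable A -> 0 <= a <= 1 -> 0 <= b <= 1 -> a <= b ->
  mixes A `]a, b].
Proof.
move=> mA a01 b01 ab; have [a0 a1] := andP a01; have [b0 b1] := andP b01.
have cI B : measurable B -> cum (B `&` `]a, b]) 1 = cum B b - cum B a.
  move=> mB; rewrite cumB ?a0//; congr (fine (mu _)); rewrite -setIA.
  congr (_ `&` _); apply/seteqP; split=> x /=; rewrite !in_itv/=; last by lra.
  by case.
rewrite /mixes (_ : (fun n => _) = (fun n =>
    cum (iter n g @^-1` A) b - cum (iter n g @^-1` A) a)); last first.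
  by apply/funext => n; rewrite cI//; exact: measurable_iter.
rewrite -[X in _ --> _ * cum X 1]setTI cI// !cumT// mulrC mulrBl.
by apply: cvgB; exact: cum_cvg.
Qed.

(** Replacing [B] by a smaller set changes both sides by at most the measure of
    the difference, uniformly in [n]. *)
Lemma mixes_approx A B : measurable A -> measurable B ->
  (forall e, 0 < e -> exists B', [/\ measurable B', B' `<=` B, mixes A B' &
     cum B 1 - cum B' 1 < e]) -> mixes A B.
Proof.
move=> mA mB approx; apply/cvgrPdistC_le => e e0.
have e40 : 0 < e / 2 by rewrite divr_gt0.
have [B' [mB' B'B mixB' BB']] := approx _ e40.
have /cvgrPdistC_le/(_ _ e40) := mixB'; apply: filterS => n.
have mAn := measurable_iter n mA.
set An := iter n g @^-1` A in mAn *.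
have dE C : measurable C ->
    cum (C `&` (B `\` B')) 1 = cum (C `&` B) 1 - cum (C `&` B') 1.
  move=> mC; rewrite setIDA cumD//; last exact: measurableI.
  by rewrite -setIA (setIidr B'B).
have mD : measurable (B `\` B') by exact: measurableD.
have An_ge := cum_ge0 (An `&` (B `\` B')) 1.
have An_le : cum (An `&` (B `\` B')) 1 <= cum (B `\` B') 1.
  by apply: cum_le => //; exact: measurableI.
have := dE setT measurableT; rewrite !setTI => DE.
rewrite dE// in An_ge An_le; rewrite DE in An_le.
have A0 := cum_ge0 A 1; have A1 := cum_le_id mA (@ler01 R).
have BB'0 : cum B' 1 <= cum B 1 by exact: cum_le.
have : 0 <= cum A 1 * (cum B 1 - cum B' 1) <= cum B 1 - cum B' 1.
  by rewrite mulr_ge0 ?subr_ge0//= ler_piMl ?subr_ge0.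
rewrite !ler_norml mulrBr => /andP[h1 h2] /andP[h3 h4].
by apply/andP; split; lra.
Qed.

Lemma mixes_setD A B C : measurable A -> measurable B -> measurable C ->
  C `<=` B -> mixes A B -> mixes A C -> mixes A (B `\` C).
Proof.
move=> mA mB mC CB AB AC; rewrite /mixes.
rewrite cumD// (setIidr CB) mulrBr (_ : (fun n => _) = (fun n =>
    cum (iter n g @^-1` A `&` B) 1 - cum (iter n g @^-1` A `&` C) 1)).
  exact: cvgB.
apply/funext => n; have mAn := measurable_iter n mA.
by rewrite setIDA cumD -?setIA ?(setIidr CB)//; exact: measurableI.
Qed.

Lemma mixes_setU A B C : measurable A -> measurable B -> measurable C ->
  B `&` C = set0 -> mixes A B -> mixes A C -> mixes A (B `|` C).
Proof.
move=> mA mB mC BC0 AB AC; rewrite /mixes.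
rewrite cumU// mulrDr (_ : (fun n => _) = (fun n =>
    cum (iter n g @^-1` A `&` B) 1 + cum (iter n g @^-1` A `&` C) 1)).
  exact: cvgD.
apply/funext => n; have mAn := measurable_iter n mA.
rewrite setIUr cumU//; [exact: measurableI|exact: measurableI|].
by rewrite setIACA BC0 setI0.
Qed.

Lemma mixes_bigsetU A (F : (set R)^nat) : measurable A ->
  (forall k, measurable (F k)) -> trivIset setT F ->
  (forall k, mixes A (F k)) -> forall n, mixes A (\big[setU/set0]_(k < n) F k).
Proof.
move=> mA mF tF AF; elim=> [|n IHn].
  rewrite big_ord0 /mixes -(set_itvoc0 (0 : R)).
  by apply: mixes_oc; rewrite ?lexx ?ler01.
rewrite big_ord_recr/=; apply: mixes_setU => //.
- exact: bigsetU_measurable.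
- apply: (@trivIset_bigsetUI _ predT F _ n n) => // i j _ _; exact: tF.
Qed.

Lemma mixes_bigcup A (F : (set R)^nat) : measurable A ->
  (forall k, measurable (F k)) -> trivIset setT F ->
  (forall k, mixes A (F k)) -> mixes A (\bigcup_k F k).
Proof.
move=> mA mF tF AF; have mU : measurable (\bigcup_k F k) by exact: bigcupT_measurable.
apply: mixes_approx => // e e0.
pose G n := \big[setU/set0]_(k < n.+1) F k.
have mG n : measurable (G n) by exact: bigsetU_measurable.
have GU n : G n `<=` \bigcup_k F k by exact: bigsetU_bigcup.
have : mu (G n `&` `]0, 1]) @[n --> \oo] --> mu (\bigcup_n (G n `&` `]0, 1])).
  apply: nondecreasing_cvg_mu.
  - by move=> n; exact: measurableI.
  - by apply: bigcupT_measurable => n; exact: measurableI.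
  - move=> m n mn; apply/subsetPset; apply: setSI; exact: subset_bigsetU.
rewrite -setI_bigcupl (_ : \bigcup_n G n = \bigcup_n F n); last first.
  exact: bigcup_bigsetU_bigcup.
rewrite -[X in _ --> X]fineK ?mu_itv_fin// => /fine_cvg/=.
move=> /cvgrPdist_lt/(_ _ e0)[n _ /(_ n (leqnn n))] Gn.
exists (G n); split => //; first exact: mixes_bigsetU.
exact: le_lt_trans (ler_norm _) Gn.
Qed.

(** The sets [B] that mix with [A] form a Dynkin system containing the half-open
    intervals, for which the claim is the convergence of the cumulative mass. *)
Theorem markov_mixes A B : measurable A -> measurable B -> mixes A B.
Proof.
move=> mA mB.
have mAn n := measurable_iter n mA.
apply: (@dynkin_induction _ (measurableTypeR R) (@ocitv R) (mixes A)) => //.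
- exact: ocitvI.
- rewrite /mixes (cumT ler01) mulr1 (_ : (fun n => _) = cst (cum A 1)).
    exact: cvg_cst.
  by apply/funext => n; rewrite setIT cum1_iter.
(* Clamping the endpoints does not change the trace on the unit interval. *)
- move=> _ [[a b] _ <-] /=.
  pose a' := Num.min 1 (Num.max 0 a); pose b' := Num.max a' (Num.min 1 b).
  have abE : `]a, b] `&` `]0, 1] = `]a', b'] `&` `]0, 1] :> set R.
    apply/seteqP; split => x /=; rewrite !in_itv/= /b' /a';
      rewrite !(gt_min, lt_max, gt_max, le_min, le_max, ge_min, ge_max); lra.
  have cE C : cum (C `&` `]a, b]) 1 = cum (C `&` `]a', b']) 1.
    by rewrite /cum -setIA abE setIA.
  rewrite /mixes -[X in _ --> _ * cum X 1]setTI cE setTI.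
  rewrite (_ : (fun n => _) = (fun n => cum (iter n g @^-1` A `&` `]a', b']) 1)).
    apply: mixes_oc => //; rewrite /b' /a';
    rewrite !(ge_max, le_max, ge_min, le_min, lexx, ler01, orbT)//=.
  by apply/funext => n; rewrite cE.
- move=> S mS AS; rewrite -setTD; apply: mixes_setD => //.
  rewrite /mixes (cumT ler01) mulr1 (_ : (fun n => _) = cst (cum A 1)).
    exact: cvg_cst.
  by apply/funext => n; rewrite setIT cum1_iter.
- by move=> F mF tF AF; exact: mixes_bigcup.
Qed.

End markov_mixing.

(** * Piecewise affine paths along walks on the grid *)

Section walks.
Local Open Scope nat_scope.

Definition adj : rel nat := fun u v => (v == u.+1) || (u == v.+1).
(** The edge between [j] and [j.+1] is numbered by [j], as is the cell above it. *)
Definition edges (u : nat) (w : seq nat) : seq nat := pairmap minn u w.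

Lemma edges_cat u w1 w2 :
  edges u (w1 ++ w2) = edges u w1 ++ edges (last u w1) w2.
Proof. exact: pairmap_cat. Qed.

Lemma walk_up lo m : exists w, [/\ path adj lo w, last lo w = lo + m,
  all (fun v => lo <= v <= lo + m) w &
  forall e, lo <= e < lo + m -> e \in edges lo w].
Proof.
elim: m => [|m [w [pw lw bw cw]]].
  by exists [::]; split=> //= [|e]; rewrite addn0//;
    case: leqP => //= /ltnW; case: ltngtP.
exists (rcons w (lo + m.+1)); split.
- by rewrite rcons_path pw lw /adj addnS eqxx.
- by rewrite last_rcons.
- rewrite all_rcons leq_addr leqnn /=.
  apply: sub_all bw => v /andP[-> /leq_trans] -> //.
  by rewrite leq_add2l.
- move=> e; rewrite -cats1 edges_cat mem_cat lw /= inE addnS ltnS.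
  move=> /andP[le]; rewrite leq_eqVlt => /predU1P[->|em].
    by rewrite (minn_idPl (leqnSn _)) eqxx orbT.
  by rewrite cw ?le.
Qed.

Lemma walk_down lo m : exists w, [/\ path adj (lo + m) w, last (lo + m) w = lo &
  all (fun v => lo <= v <= lo + m) w].
Proof.
elim: m => [|m [w [pw lw bw]]]; first by exists [::]; rewrite /= addn0.
exists (lo + m :: w); split => //=.
  by rewrite pw /adj addnS eqxx orbT.
rewrite leq_addr leq_add2l leqnSn/=; apply: sub_all bw => v /andP[-> /leq_trans] -> //.
by rewrite leq_add2l.
Qed.

(** Go down to [lo], up to [hi], and down again to [b]: the middle leg crosses every
    edge. *)
Lemma walk_covering lo hi a b : lo <= a <= hi -> lo <= b <= hi ->
  exists w, [/\ path adj a w, last a w = b,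
    all (fun v => lo <= v <= hi) w &
    forall e, lo <= e < hi -> e \in edges a w].
Proof.
move=> /andP[loa ahi] /andP[lob bhi].
have lohi := leq_trans loa ahi.
have [w1 []] := walk_down lo (a - lo); rewrite subnKC// => p1 l1 b1.
have [w2 []] := walk_up lo (hi - lo); rewrite subnKC// => p2 l2 b2 c2.
have [w3 []] := walk_down b (hi - b); rewrite subnKC// => p3 l3 b3.
exists (w1 ++ w2 ++ w3); split.
- by rewrite !cat_path p1 l1 p2 l2.
- by rewrite !last_cat l1 l2.
- rewrite !all_cat b2 /=; apply/andP; split.
    by apply: sub_all b1 => v /andP[-> /leq_trans]; exact.
  by apply: sub_all b3 => v /andP[/(leq_trans lob) -> ->].
- by move=> e /c2 ec; rewrite !edges_cat l1 !mem_cat ec orbT.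
Qed.

Lemma edges_bound lo hi a w : lo <= a <= hi -> path adj a w ->
  all (fun v => lo <= v <= hi) w -> forall e, e \in edges a w -> lo <= e < hi.
Proof.
elim: w a => //= v w IHw a ab /andP[av pw] /andP[vb wb] e.
rewrite inE => /predU1P[->|]; last exact: IHw.
by move: av ab vb; rewrite /adj => /orP[]/eqP->; lia.
Qed.

End walks.

Lemma sum_count {R : realType} (M : nat) (s : seq nat) (F : nat -> R) :
  {in s, forall e, (e < M)%N} ->
  \sum_(e <- s) F e = \sum_(j < M) (count_mem (j : nat) s)%:R * F j.
Proof.
elim: s => [|e s IHs] sM.
  by rewrite big_nil big1// => j _; rewrite mul0r.
have eM : (e < M)%N by apply: sM; rewrite mem_head.
have Fe : \sum_(j < M) (e == j)%:R * F j = F e.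
  rewrite (bigD1 (Ordinal eM))//= eqxx mul1r big1 ?addr0// => j.
  by rewrite -val_eqE/= eq_sym => /negbTE ->; rewrite mul0r.
rewrite big_cons IHs => [|k ks]; last by apply: sM; rewrite in_cons ks orbT.
rewrite -Fe -big_split; apply: eq_bigr => j _ /=.
by rewrite natrD mulrDl.
Qed.

Lemma ratio_itv01 {R : realFieldType} (a d : R) : 0 < d -> 0 <= a <= d ->
  0 <= a / d <= 1.
Proof.
move=> d0 /andP[a0 ad].
by rewrite divr_ge0 ?(ltW d0)//= ler_pdivrMr// mul1r.
Qed.

Section piecewise_linear.
Context {R : realType} {N : nat}.
Local Notation grid := (@grid R N).
Local Notation mass := (@mass R N).
Local Notation measurable := (@measurable _ (measurableTypeR R)).
Implicit Types (r : nat -> R) (x t : R) (u v : nat) (w : seq nat).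

(** The path that starts at time [x] at height [grid u], follows the walk [w], and
    spends time [r e] on each crossing of the edge [e]. Each crossing contributes a
    clamped linear term, so that the function is defined and continuous on the whole
    line and constant outside its time interval. *)
Fixpoint pl r x u w t : R := if w is v :: w' then
    let y := x + r (minn u v) in
    pl r y v w' t + (grid v - grid u) / r (minn u v) * (Num.min (Num.max t x) y - y)
  else grid u.

Definition duration r u w : R := \sum_(e <- edges u w) r e.

Definition positive_on r u w := {in edges u w, forall e, 0 < r e}.

Lemma duration_cons r u v w :
  duration r u (v :: w) = r (minn u v) + duration r v w.
Proof. by rewrite /duration /= big_cons. Qed.

Lemma positive_on_cons r u v w : positive_on r u (v :: w) ->
  0 < r (minn u v) /\ positive_on r v w.
Proof.
move=> r0; split; first by apply: r0; rewrite mem_head.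
by move=> e ew; apply: r0; rewrite /= in_cons ew orbT.
Qed.

Lemma duration_ge0 r u w : positive_on r u w -> 0 <= duration r u w.
Proof. by move=> r0; rewrite /duration big_seq sumr_ge0// => e /r0/ltW. Qed.

Lemma pl_continuous r x u w : continuous (pl r x u w).
Proof.
elim: w x u => [|v w IHw] x u t /=; first exact: cvg_cst.
apply: cvgD; first exact: IHw.
apply: cvgM; first exact: cvg_cst.
apply: cvgB; last exact: cvg_cst.
apply: (@continuous_min R R (fun s => Num.max s x) 
  (cst (x + r (minn u v)))); last exact: cvg_cst.
by apply: (@continuous_max R R id (cst x)); [exact: cvg_id|exact: cvg_cst].
Qed.

Lemma pl_left r x u w t : positive_on r u w -> t <= x -> pl r x u w t = grid u.
Proof.
elim: w x u => [//|v w IHw] x u /positive_on_cons[r0 rw] tx /=.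
rewrite IHw//; last by rewrite (le_trans tx)// lerDl ltW.
rewrite (max_idPr tx) min_l ?lerDl ?ltW//; field; exact: lt0r_neq0.
Qed.

Lemma pl_right r x u w t : positive_on r u w -> x + duration r u w <= t ->
  pl r x u w t = grid (last u w).
Proof.
elim: w x u => [//|v w IHw] x u /positive_on_cons[r0 rw].
rewrite duration_cons addrA => tx /=; rewrite IHw//.
have tx' : x + r (minn u v) <= t by rewrite (le_trans _ tx)// lerDl duration_ge0.
by rewrite min_r ?subrr ?mulr0 ?addr0// le_max tx'.
Qed.

Lemma pl_cons_later r x u v w t : x + r (minn u v) <= t ->
  pl r x u (v :: w) t = pl r (x + r (minn u v)) v w t.
Proof. by move=> tx /=; rewrite min_r ?subrr ?mulr0 ?addr0// le_max tx. Qed.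

Lemma pl_cons_first r x u v w t : positive_on r u (v :: w) ->
  x <= t <= x + r (minn u v) ->
  pl r x u (v :: w) t = grid u + (grid v - grid u) / r (minn u v) * (t - x).
Proof.
move=> /positive_on_cons[r0 rw] /andP[xt tx] /=.
rewrite pl_left// (max_idPl xt) (min_idPl tx); field; exact: lt0r_neq0.
Qed.

Lemma pl_bound r x u w lo hi t : positive_on r u w ->
  (lo <= u <= hi)%N -> all (fun v => lo <= v <= hi)%N w ->
  grid lo <= pl r x u w t <= grid hi.
Proof.
elim: w x u => [|v w IHw] x u.
  by move=> _ + _ /=; rewrite !ler_grid.
move=> r0 ub /=/andP[vb wb]; have [r0' rw] := positive_on_cons r0.
have [tx|/ltW tx] := leP (x + r (minn u v)) t.
  by rewrite -[_ + _]/(pl r x u (v :: w) t) pl_cons_later//; exact: IHw.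
rewrite -[_ + _]/(pl r x u (v :: w) t).
have [xt|/ltW xt] := leP x t; last by rewrite pl_left// !ler_grid.
rewrite pl_cons_first ?xt ?tx//.
have /andP[h1 h2] : 0 <= (t - x) / r (minn u v) <= 1.
  by apply: ratio_itv01 => //; rewrite subr_ge0 xt lerBlDl.
rewrite mulrAC -mulrA; move: ((t - x) / _) h1 h2 => z z0 z1.
have := ub; have := vb; rewrite -!(@ler_grid R N) => /andP[h1 h2] /andP[h3 h4].
by apply/andP; split; nra.
Qed.

Lemma edge_slope u v : adj u v -> `|grid v - grid u| = N.+1%:R^-1.
Proof.
case/orP => /eqP ->; first by rewrite gridS addrC addKr ger0_norm.
by rewrite gridS distrC addrC addKr ger0_norm.
Qed.

(** Crossing an edge in either direction sees the mass of its cell with a positive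
    sign. *)
Lemma edge_mass A u v : adj u v ->
  (cum A (grid v) - cum A (grid u)) / (grid v - grid u) = N.+1%:R * mass A (minn u v).
Proof.
have N0 : N.+1%:R != 0 :> R by rewrite pnatr_eq0.
case/orP => /eqP ->.
  rewrite (minn_idPl (leqnSn _)) /mass gridS [X in _ / (X - _)]addrC addrK invrK.
  by rewrite mulrC.
rewrite (minn_idPr (leqnSn _)) /mass gridS opprD addrA subrr sub0r.
by rewrite invrN invrK; ring.
Qed.

(** A path covers one cell; [g] stands for the glued map, which agrees with the path
    there. *)
Section along.
Variables (g : R -> R).
Hypothesis g_cont : continuous g.

Lemma segment_transfer A r x u v w t : measurable A ->
  adj u v -> positive_on r u (v :: w) -> 0 <= x ->
  (forall t, x <= t <= x + r (minn u v) -> g t = pl r x u (v :: w) t) ->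
  x <= t <= x + r (minn u v) ->
  cum (g @^-1` A) t - cum (g @^-1` A) x =
  r (minn u v) / (grid v - grid u) * (cum A (g t) - cum A (grid u)).
Proof.
move=> mA uv r0 x0 gE /andP[xt tx]; have [r0' rw] := positive_on_cons r0.
have gx : g x = grid u by rewrite gE ?pl_left// lexx lerDl ltW.
have gvu : grid v - grid u != 0.
  by rewrite -normr_gt0 edge_slope// invr_gt0.
have ge0 s : x <= s <= x + r (minn u v) -> 0 <= g s.
  move=> xs; rewrite gE// pl_cons_first//.
  have /andP[h1 h2] : 0 <= (s - x) / r (minn u v) <= 1.
    by apply: ratio_itv01 => //; rewrite subr_ge0 lerBlDl.
  rewrite mulrAC -mulrA; move: ((s - x) / _) h1 h2 => z z0 z1.
  by have := grid_ge0 (R := R) (N := N) u; have := grid_ge0 (R := R) (N := N) v; nra.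
rewrite (@cum_affine _ g A x t ((grid v - grid u) / r (minn u v)))//.
- by rewrite gx invf_div.
- by rewrite x0.
- by rewrite mulf_neq0// invr_eq0 lt0r_neq0.
- move=> s /andP[xs st]; have xs' : x <= s <= x + r (minn u v).
    by rewrite xs (le_trans st).
  by rewrite gx gE// pl_cons_first.
- by rewrite gx grid_ge0.
- by rewrite ge0// xt.
Qed.

Lemma edge_transfer A r x u v w : measurable A ->
  adj u v -> positive_on r u (v :: w) -> 0 <= x ->
  (forall t, x <= t <= x + r (minn u v) -> g t = pl r x u (v :: w) t) ->
  cum (g @^-1` A) (x + r (minn u v)) - cum (g @^-1` A) x =
  N.+1%:R * r (minn u v) * mass A (minn u v).
Proof.
move=> mA uv r0 x0 gE; have [r0' rw] := positive_on_cons r0.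
have xr : x <= x + r (minn u v) <= x + r (minn u v) by rewrite lexx lerDl ltW.
have gv : g (x + r (minn u v)) = grid v.
  by rewrite gE// pl_cons_later ?pl_left.
rewrite (segment_transfer mA uv r0 x0 gE)// gv.
by rewrite -mulrA [_^-1 * _]mulrC edge_mass//; ring.
Qed.

(** While an edge is crossed in time [r e], in either direction, the preimage gains the
    mass of [A] in the cell of that edge times [N.+1 * r e]. *)
Lemma walk_transfer A r x u w : measurable A -> path adj u w ->
  positive_on r u w -> 0 <= x ->
  (forall t, x <= t <= x + duration r u w -> g t = pl r x u w t) ->
  cum (g @^-1` A) (x + duration r u w) - cum (g @^-1` A) x =
  \sum_(e <- edges u w) N.+1%:R * r e * mass A e.
Proof.
move=> mA; elim: w x u => [|v w IHw] x u /=.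
  by rewrite /duration !big_nil addr0 subrr.
move=> /andP[uv pw] r0 x0; have [r0' rw] := positive_on_cons r0.
rewrite duration_cons addrA => gE.
have rD : x <= x + r (minn u v) <= x + r (minn u v) + duration r v w.
  by rewrite !lerDl (ltW r0') duration_ge0.
have [xr rd] := andP rD.
have gE1 t : x <= t <= x + r (minn u v) -> g t = pl r x u (v :: w) t.
  by move=> /andP[xt tx]; rewrite gE// xt (le_trans tx).
have gE2 t : x + r (minn u v) <= t <= x + r (minn u v) + duration r v w ->
    g t = pl r (x + r (minn u v)) v w t.
  by move=> /andP[xt tx]; rewrite gE ?tx ?(le_trans xr)//; exact: pl_cons_later.
rewrite big_cons -(IHw _ _ pw rw _ gE2); last by rewrite addr_ge0// ltW.
by rewrite -(edge_transfer mA uv r0 x0 gE1); ring.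
Qed.

Definition mass_linear (L : set R -> R) := exists q : 'I_N.+1 -> R,
  forall A, measurable A -> L A = \sum_j q j * mass A j.

Lemma mass_linearD L1 L2 : mass_linear L1 -> mass_linear L2 ->
  mass_linear (fun A => L1 A + L2 A).
Proof.
move=> [q1 e1] [q2 e2]; exists (fun j => q1 j + q2 j) => A mA.
by rewrite e1// e2// -big_split/=; apply: eq_bigr => j _; rewrite mulrDl.
Qed.

Lemma mass_linearZ c L : mass_linear L -> mass_linear (fun A => c * L A).
Proof.
move=> [q e]; exists (fun j => c * q j) => A mA.
by rewrite e// mulr_sumr; apply: eq_bigr => j _; rewrite mulrA.
Qed.

Lemma mass_linear0 : mass_linear (fun=> 0).
Proof. by exists (fun=> 0) => A mA; rewrite big1// => j _; rewrite mul0r. Qed.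

Lemma mass_linear_mass e : (e < N.+1)%N -> mass_linear (fun A => mass A e).
Proof.
move=> eN; exists (fun j => (j == Ordinal eN)%:R) => A mA.
rewrite (bigD1 (Ordinal eN))//= eqxx mul1r big1 ?addr0// => j /negbTE ->.
by rewrite mul0r.
Qed.

Lemma mass_linear_sum m (L : nat -> set R -> R) :
  (forall k, (k < m)%N -> mass_linear (L k)) ->
  mass_linear (fun A => \sum_(k < m) L k A).
Proof.
elim: m => [|m IHm] lL.
  have [q e] := mass_linear0; exists q => A mA; rewrite -e//.
  by rewrite big_ord0.
have [q e] := mass_linearD (IHm (fun k km => lL k (ltnW km))) (lL m (ltnSn m)).
by exists q => A mA; rewrite -e// big_ord_recr.
Qed.

Lemma mass_linear_cum k : (k <= N.+1)%N -> mass_linear (fun A => cum A (grid k)).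
Proof.
move=> kN; have [|q e] := @mass_linear_sum k (fun j A => mass A j).
  by move=> j jk; apply: mass_linear_mass; exact: leq_trans kN.
by exists q => A mA; rewrite -e// cum_grid.
Qed.

(** Full crossings contribute multiples of cell masses. Only the crossing in
    progress at time [t] contributes a cumulative mass at an arbitrary point, with
    factor the inverse slope. *)
Lemma walk_contract r x u w c0 t : path adj u w -> positive_on r u w ->
  (u <= N.+1)%N -> all (fun v => v <= N.+1)%N w -> 0 <= x ->
  {in edges u w, forall e, N.+1%:R * r e <= c0} -> 0 <= c0 ->
  (forall t, x <= t <= x + duration r u w -> g t = pl r x u w t) ->
  x <= t <= x + duration r u w ->
  exists L c t', [/\ mass_linear L, 0 <= t' <= 1, `|c| <= c0 &
    forall A, measurable A ->
      cum (g @^-1` A) t = cum (g @^-1` A) x + L A + c * cum A t'].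
Proof.
move=> pw0 r0 uN wN x0 rc c00; elim: w x u pw0 r0 uN wN x0 rc => [|v w IHw] x u.
  move=> _ _ _ _ _ _ _; rewrite /duration big_nil addr0 => xt.
  exists (fun=> 0), 0, 0; split; rewrite ?lexx ?ler01 ?normr0//.
    exact: mass_linear0.
  by move=> A mA; rewrite mul0r !addr0; congr (cum _ _); lra.
rewrite [path _ _ _]/= => /andP[uv pw] r0 uN /=/andP[vN wN] x0 rc.
have [r0' rw] := positive_on_cons r0.
rewrite duration_cons addrA => gE /andP[xt tx].
have rD : x <= x + r (minn u v) <= x + r (minn u v) + duration r v w.
  by rewrite !lerDl (ltW r0') duration_ge0.
have [xr rd] := andP rD.
have gE1 s : x <= s <= x + r (minn u v) -> g s = pl r x u (v :: w) s.
  by move=> /andP[xs sx]; rewrite gE// xs (le_trans sx).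
have gE2 s : x + r (minn u v) <= s <= x + r (minn u v) + duration r v w ->
    g s = pl r (x + r (minn u v)) v w s.
  by move=> /andP[xs sx]; rewrite gE ?sx ?(le_trans xr)//; exact: pl_cons_later.
have eN : (minn u v < N.+1)%N.
  by move: uv uN vN; rewrite /adj => /orP[]/eqP->; lia.
have [tr|/ltW tr] := leP (x + r (minn u v)) t.
  have [|||L [c [t' [lL t'01 cc0 LE]]]] := IHw _ _ pw rw vN wN _ _ gE2.
  - by rewrite addr_ge0// ltW.
  - by move=> e ew; apply: rc; rewrite in_cons ew orbT.
  - by rewrite tr tx.
  exists (fun A => N.+1%:R * r (minn u v) * mass A (minn u v) + L A), c, t'; split=> //.
    by apply: mass_linearD => //; apply: mass_linearZ; exact: mass_linear_mass.
  move=> A mA; rewrite LE//.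
  by rewrite -(edge_transfer mA uv r0 x0 gE1); ring.
pose c := r (minn u v) / (grid v - grid u).
exists (fun A => - c * cum A (grid u)), c, (g t); split.
- by apply: mass_linearZ; exact: mass_linear_cum.
- rewrite gE1 ?xt//.
  have := @pl_bound r x u (v :: w) 0 N.+1 t r0.
  rewrite grid0 gridN; apply; first by rewrite uN.
  by rewrite /= vN; apply: sub_all wN.
- rewrite /c normrM normfV edge_slope// invrK gtr0_norm// mulrC.
  by apply: rc; rewrite mem_head.
move=> A mA; apply: (@addIr _ (- cum (g @^-1` A) x)).
rewrite (segment_transfer mA uv r0 x0 gE1) ?xt// -/c; ring.
Qed.

End along.
End piecewise_linear.

(** * A mixing map with a prescribed transition matrix *)

Section markov_map.
Context {R : realType} {N : nat}.
Local Notation grid := (@grid R N).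
Local Notation mass := (@mass R N).
Local Notation pl := (@pl R N).
Local Notation measurable := (@measurable _ (measurableTypeR R)).

Section gluing.
Variables (r : nat -> nat -> R) (a : nat -> nat) (w : nat -> seq nat).
Hypothesis w_last : forall i, (i < N.+1)%N -> last (a i) (w i) = a i.+1.
Hypothesis r_pos : forall i, (i < N.+1)%N -> positive_on (r i) (a i) (w i).
Hypothesis r_dur : forall i, (i < N.+1)%N -> duration (r i) (a i) (w i) = N.+1%:R^-1.

(** On the cell [i] the paths before it have reached their end and those after it
    are still at their start, so the sum telescopes to the path number [i]. *)
Definition glue t : R := grid (a 0) +
  \sum_(0 <= k < N.+1) (pl (r k) (grid k) (a k) (w k) t - grid (a k)).

Lemma glue_continuous : continuous glue.
Proof.
move=> t; apply: cvgD; first exact: cvg_cst.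
apply: cvg_sumr => k; apply: cvgB; last exact: cvg_cst.
exact: pl_continuous.
Qed.

Lemma glueE i t : (i < N.+1)%N -> grid i <= t <= grid i.+1 ->
  glue t = pl (r i) (grid i) (a i) (w i) t.
Proof.
move=> iN /andP[it ti].
have later : \sum_(i.+1 <= k < N.+1)
    (pl (r k) (grid k) (a k) (w k) t - grid (a k)) = 0.
  rewrite big_nat; apply: big1 => k /andP[ik kN].
  by rewrite (pl_left (r_pos kN)) ?subrr// (le_trans ti)// ler_grid.
have earlier : \sum_(0 <= k < i) (pl (r k) (grid k) (a k) (w k) t - grid (a k)) =
    grid (a i) - grid (a 0).
  rewrite -(telescope_sumr (fun k => grid (a k)))//.
  apply: eq_big_nat => k /andP[_ ki]; have kN := ltn_trans ki iN.
  rewrite (pl_right (r_pos kN)) ?w_last//.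
  by rewrite r_dur// -gridS (le_trans _ it)// ler_grid.
rewrite /glue (@big_cat_nat _ _ _ i) ?(ltnW iN)//= earlier.
by rewrite big_ltn// later addr0; ring.
Qed.

End gluing.

Lemma cell_of t : 0 <= t <= 1 ->
  exists2 i : 'I_N.+1, grid i <= t & t <= grid i.+1.
Proof.
move=> /andP[t0 t1].
have [i [iN ti]] : exists i, (i < N.+1)%N /\ t <= grid i.+1.
  by exists N; split => //; rewrite gridN.
have [] := @arg_minnP _ (Ordinal iN) (fun i : 'I_N.+1 => t <= grid i.+1) val ti.
move=> [[|j] jN] /= tj jmin; exists (Ordinal jN) => //=; first by rewrite grid0.
have [//|/ltW tj'] := leP (grid j.+1) t.
by have := jmin (Ordinal (ltnW jN)) tj'; rewrite /= ltnn.
Qed.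

Variables (P : 'I_N.+1 -> 'I_N.+1 -> R).
Hypothesis N_gt0 : (0 < N)%N.
Hypothesis P_ge0 : forall i j, 0 <= P i j.
Hypothesis P_row : forall i, \sum_j P i j = 1.
Hypothesis P_col : forall j, \sum_i P i j = 1.
Hypothesis P_adj : forall i i' : 'I_N.+1, i' = i.+1 :> nat ->
  exists2 j, 0 < P i j & 0 < P i' j.
Hypothesis P_interval : forall i (j1 j j2 : 'I_N.+1), (j1 <= j <= j2)%N ->
  0 < P i j1 -> 0 < P i j2 -> 0 < P i j.

(** An entry equal to 1 would be alone in its row and in its column, but a
    neighbouring row must share a positive column with it. This makes every
    branch of the map strictly expanding. *)
Lemma entry_lt1 i j : P i j < 1.
Proof.
have [i' [j' [i'i Pij' Pi'j']]] : exists i' j', [/\ i' != i, 0 < P i j' & 0 < P i' j'].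
  have [iN|iN] := ltnP i N.
    have iN' : (i.+1 < N.+1)%N by [].
    have [j' ? ?] := @P_adj i (Ordinal iN') erefl.
    by exists (Ordinal iN'), j'; split=> //; rewrite -val_eqE/= gtn_eqF.
  have iE : i = N :> nat by apply/eqP; rewrite eqn_leq iN -ltnS ltn_ord.
  have iN' : (i.-1 < N.+1)%N by rewrite (leq_ltn_trans (leq_pred _)).
  have [|j' ? ?] := @P_adj (Ordinal iN') i; first by rewrite /= prednK// iE.
  by exists (Ordinal iN'), j'; split=> //; rewrite -val_eqE/= iE; lia.
have [->|j'j] := eqVneq j j'.
  rewrite -(P_col j') (bigD1 i)//= (bigD1 i')//= ltrDl ltr_wpDr//.
  by apply: sumr_ge0.
rewrite -(P_row i) (bigD1 j)//= (bigD1 j')//= 1?eq_sym// ltrDl ltr_wpDr//.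
exact: sumr_ge0.
Qed.

Lemma entries_bounded : exists2 c : R, 0 <= c < 1 & forall i j, P i j <= c.
Proof.
exists (\big[Num.max/0]_i \big[Num.max/0]_j P i j).
  apply/andP; split; first exact: bigmax_ge_id.
  by apply: bigmax_lt => // i _; apply: bigmax_lt => // j _; exact: entry_lt1.
move=> i j; apply: (le_trans _ (le_bigmax _ _ i)) => /=.
exact: (le_bigmax _ (fun j => P i j)).
Qed.

Lemma row_support i : exists lo hi, [/\ (lo < hi)%N, (hi <= N.+1)%N &
  forall j : 'I_N.+1, (0 < P i j) = (lo <= j < hi)%N].
Proof.
have [j0 Pj0] : exists j, 0 < P i j.
  apply/existsP; apply: contraT; rewrite negb_exists => /forallP P0.
  have := P_row i; rewrite big1 => [/eqP|j _]; first by rewrite eq_sym oner_eq0.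
  by apply/eqP; rewrite eq_le P_ge0 andbT leNgt P0.
have [lo Plo lomin] := @arg_minnP _ j0 (fun j => 0 < P i j) val Pj0.
have [hi Phi himax] := @arg_maxnP _ j0 (fun j => 0 < P i j) val Pj0.
exists lo, hi.+1; split => //; first by rewrite ltnS; exact: himax.
move=> j; apply/idP/idP => [Pj|/P_interval]; last exact.
by rewrite ltnS lomin//=; exact: himax.
Qed.

(** On the cell [i] the map follows a walk that crosses exactly the edges [j] with
    [0 < P i j], and spends on the edge [j] the total time [P i j / N.+1], divided
    equally between its crossings. The walks of neighbouring cells must meet at a
    common height, which the columns shared by neighbouring rows provide. The last
    property locates the values of the map by positive entries of [P]. *)
Theorem markov_map_exists : exists g : R -> R, [/\ continuous g,
  forall t, 0 <= t <= 1 -> 0 <= g t <= 1,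
  forall A, measurable A -> cum (g @^-1` A) 1 = cum A 1,
  forall A B, measurable A -> measurable B -> mixes g A B &
  forall (i : 'I_N.+1) t, grid i <= t <= grid i.+1 ->
    exists j1 j2 : 'I_N.+1, [/\ 0 < P i j1, 0 < P i j2 &
      grid j1 <= g t <= grid j2.+1]].
Proof.
have [c0 /andP[c00 c01] Pc0] := entries_bounded.
have [lo /choice[hi supp]] := choice row_support.
have lohi i : (lo i < hi i)%N by case: (supp i).
have hiN i : (hi i <= N.+1)%N by case: (supp i).
have Psupp i j : (0 < P i j) = (lo i <= j < hi i)%N by case: (supp i).
have ordE (i : 'I_N.+1) k (kN : (k < N.+1)%N) : i = k :> nat -> i = Ordinal kN.
  by move=> ik; exact: val_inj.
(* [ok k v]: the height [v] is available at time [grid k] to the cells on both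
   sides. *)
pose ok k v := forall i : 'I_N.+1, i = k :> nat \/ i.+1 = k :> nat ->
  (lo i <= v <= hi i)%N.
have /choice[a a_ok] : forall k, exists v, ok k v.
  move=> [|k].
    exists (lo ord0) => i [i0|//]; have -> : i = ord0 by exact: val_inj.
    by rewrite leqnn ltnW.
  have [kN|kN] := ltnP k.+1 N.+1.
    have kN' := ltnW kN.
    have [j] := @P_adj (Ordinal kN') (Ordinal kN) erefl.
    rewrite !Psupp => /andP[h1 h2] /andP[h3 h4]; exists j => i [ik|[ik]].
      by rewrite (ordE _ _ kN ik) h3 ltnW.
    by rewrite (ordE _ _ kN' ik) h1 ltnW.
  exists (hi (inord k)) => i [ik|[ik]]; first by have := ltn_ord i; lia.
  by rewrite -ik inord_val leqnn ltnW.
have /choice[w w_ok] : forall k, exists w, forall i : 'I_N.+1, i = k :> nat ->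
    [/\ path adj (a k) w, last (a k) w = a k.+1,
      all (fun v => lo i <= v <= hi i)%N w &
      forall e, (lo i <= e < hi i)%N -> e \in edges (a k) w].
  move=> k; have [kN|kN] := ltnP k N.+1; last first.
    by exists [::] => i ik; have := ltn_ord i; lia.
  have [||w wP] := @walk_covering (lo (Ordinal kN)) (hi (Ordinal kN)) (a k) (a k.+1).
  - by apply: a_ok; left.
  - by apply: a_ok; right.
  by exists w => i ik; rewrite (ordE _ _ kN ik).
pose cnt k e := count_mem e (edges (a k) (w k)).
pose r k e : R := P (inord k) (inord e) / (N.+1%:R * (cnt k e)%:R).
have N0 : 0 < N.+1%:R :> R by [].
have e_supp (i : 'I_N.+1) e : e \in edges (a i) (w i) -> (lo i <= e < hi i)%N.
  have [pw _ wb _] := w_ok _ i erefl.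
  by apply: edges_bound => //; apply: a_ok; left.
have e_lt (i : 'I_N.+1) e : e \in edges (a i) (w i) -> (e < N.+1)%N.
  by move=> /e_supp/andP[_ /leq_trans]; exact.
have e_pos (i : 'I_N.+1) e : e \in edges (a i) (w i) ->
    0 < P (inord i) (inord e) /\ 0 < (cnt i e)%:R :> R.
  move=> ei; have eN := e_lt _ _ ei.
  rewrite inord_val Psupp inordK// e_supp//; split=> //.
  by rewrite ltr0n /cnt -has_count has_pred1.
have r_pos (i : 'I_N.+1) : positive_on (r i) (a i) (w i).
  by move=> e /e_pos[h1 h2]; rewrite /r divr_gt0// mulr_gt0.
(* The crossings of the edge [j] recombine to the entry [P i j]; an edge that is not
   crossed lies outside the support, where the entry vanishes. *)
have r_sum (i : 'I_N.+1) (F : nat -> R) :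
    \sum_(e <- edges (a i) (w i)) N.+1%:R * r i e * F e = \sum_j P i j * F j.
  rewrite (@sum_count _ N.+1)//; last exact: e_lt.
  apply: eq_bigr => j _; rewrite /r inord_val inord_val -/(cnt i j).
  have [c_eq0|c_neq0] := eqVneq (cnt i j) 0%N.
    suff -> : P i j = 0 by rewrite !mul0r !mulr0 mul0r mulr0.
    apply/eqP; rewrite eq_le P_ge0 andbT leNgt Psupp; apply/negP => ij.
    have [_ _ _ /(_ _ ij)] := w_ok _ i erefl.
    by rewrite -has_pred1 has_count -/(cnt i j) c_eq0.
  have cR0 : (cnt i j)%:R != 0 :> R by rewrite pnatr_eq0.
  by field; rewrite cR0 lt0r_neq0.
have r_dur (i : 'I_N.+1) : duration (r i) (a i) (w i) = N.+1%:R^-1.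
  rewrite /duration; apply: (mulfI (lt0r_neq0 N0)).
  rewrite divff ?lt0r_neq0// mulr_sumr -[RHS](P_row i).
  transitivity (\sum_(e <- edges (a i) (w i)) N.+1%:R * r i e * 1).
    by apply: eq_bigr => e _; rewrite mulr1.
  by rewrite (r_sum i (fun=> 1)); apply: eq_bigr => j _; rewrite mulr1.
have ordP (Q : nat -> Prop) : (forall i : 'I_N.+1, Q i) ->
    forall i, (i < N.+1)%N -> Q i.
  by move=> h i iN; exact: (h (Ordinal iN)).
pose g := glue r a w.
have gE (i : 'I_N.+1) t : grid i <= t <= grid i.+1 ->
    g t = pl (r i) (grid i) (a i) (w i) t.
  apply: glueE => //.
  - by apply: ordP => k; case: (w_ok _ k erefl).
  - exact: ordP.
  - exact: ordP.
have gE' (i : 'I_N.+1) t : grid i <= t <= grid i + duration (r i) (a i) (w i) ->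
    g t = pl (r i) (grid i) (a i) (w i) t.
  by rewrite r_dur -gridS; exact: gE.
have g_cont : continuous g by exact: glue_continuous.
have g_range (i : 'I_N.+1) t : grid i <= t <= grid i.+1 ->
    grid (lo i) <= g t <= grid (hi i).
  move=> /gE ->; have [_ _ wb _] := w_ok _ i erefl.
  by apply: pl_bound => //; apply: a_ok; left.
have transfer A (i : 'I_N.+1) : measurable A ->
    mass (g @^-1` A) i = \sum_j P i j * mass A j.
  move=> mA; have [pw _ _ _] := w_ok _ i erefl.
  rewrite -r_sum -(walk_transfer g_cont mA pw (r_pos i) (grid_ge0 i) (gE' i)).
  by rewrite r_dur -gridS.
have contract t : 0 <= t <= 1 -> exists q : 'I_N.+1 -> R, exists c t' : R,
    [/\ 0 <= t' <= 1, `|c| <= c0 & forall A, measurable A ->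
      cum (g @^-1` A) t = \sum_j q j * mass A j + c * cum A t'].
  move=> /cell_of[i it ti]; have [pw _ wb _] := w_ok _ i erefl.
  have hiNi := hiN i.
  have [||||L [c [t' [lL t'01 cc0 LE]]]] :=
    @walk_contract _ _ g g_cont (r i) (grid i) (a i) (w i) c0 t pw (r_pos i) _ _
      (grid_ge0 i) _ c00 (gE' i).
  - have : (lo i <= a i <= hi i)%N by apply: a_ok; left.
    by move=> /andP[_ /leq_trans]; exact.
  - by apply: sub_all wb => v /andP[_ /leq_trans]; exact.
  - move=> e /e_pos[h1 h2].
    have -> : N.+1%:R * r i e = P (inord i) (inord e) / (cnt i e)%:R.
      by rewrite /r; field; rewrite !lt0r_neq0.
    rewrite ler_pdivrMr// (le_trans (Pc0 _ _))// ler_peMr//.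
    by rewrite ler1n -(ltr0n R).
  - by rewrite it r_dur -gridS.
  have [|q qE] := @mass_linearD _ _ (fun A => cum (g @^-1` A) (grid i)) L _ lL.
    have [|q qE] := @mass_linear_sum R N i (fun k A => mass (g @^-1` A) k).
      move=> k ki; have kN := ltn_trans ki (ltn_ord i).
      exists (P (Ordinal kN)) => A mA; exact: (transfer A (Ordinal kN)).
    by exists q => A mA; rewrite -qE// cum_grid.
  by exists q, c, t'; split=> // A mA; rewrite -qE// LE.
exists g; split => //.
- move=> t /cell_of[i it ti]; have := @g_range i t; rewrite it ti => /(_ erefl).
  move=> /andP[h1 h2]; rewrite (le_trans (grid_ge0 _) h1)/=.
  by rewrite (le_trans h2)// grid_le1.
- by move=> A mA; apply: (@cum1_preimage _ _ g P).
- by move=> A B mA mB; apply: (@markov_mixes _ _ g P c0).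
- move=> i t /g_range git.
  have loN : (lo i < N.+1)%N by exact: leq_trans (lohi i) (hiN i).
  have hi0 : (0 < hi i)%N by exact: leq_ltn_trans (lohi i).
  have hiN' : ((hi i).-1 < N.+1)%N by rewrite prednK.
  exists (Ordinal loN), (Ordinal hiN'); split; rewrite ?Psupp/=.
  + by rewrite leqnn lohi.
  + by rewrite prednK// leqnn andbT -ltnS prednK.
  + by rewrite prednK.
Qed.

End markov_map.

(** * The transition matrix of a continuous measure-preserving map *)

Section transition_matrix.
Context {R : realType} {N : nat}.
Local Notation grid := (@grid R N).
Local Notation mass := (@mass R N).
Local Notation mu := (@lebesgue_measure R).
Local Notation measurable := (@measurable _ (measurableTypeR R)).
Variable F : R -> R.
Hypothesis F_cont : continuous F.
Hypothesis F_le1 : forall x, F x <= 1.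
Hypothesis F_rays : forall y, 0 <= y <= 1 -> cum (F @^-1` `]-oo, y]) 1 = y.

Definition hit (j : nat) : set R := F @^-1` `]grid j, grid j.+1].
Definition below (j : nat) : set R := F @^-1` `]-oo, grid j].

Lemma measurable_hit j : measurable (hit j).
Proof. apply: (measurable_preim F_cont); exact: measurable_itv. Qed.

Lemma measurable_below j : measurable (below j).
Proof. apply: (measurable_preim F_cont); exact: measurable_itv. Qed.

Lemma cum_hit j t : cum (hit j) t = cum (below j.+1) t - cum (below j) t.
Proof.
have -> : hit j = below j.+1 `\` below j.
  apply/seteqP; split => x; rewrite /hit /below /= !in_itv/=.
    by move=> /andP[h ->]; split=> //; apply/negP; rewrite -ltNge.
  by move=> [-> /negP]; rewrite -ltNge andbT.
rewrite cumD; [|exact: measurable_below..]; congr (_ - cum _ _).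
apply/seteqP; split => x; rewrite /below /= !in_itv/=; first by case.
by move=> h; split=> //; rewrite (le_trans h)// ler_grid.
Qed.

Lemma cum_below0 t : 0 <= t <= 1 -> cum (below 0) t = 0.
Proof.
move=> t01; have [t0 t1] := andP t01; apply/eqP; rewrite eq_le cum_ge0 andbT.
rewrite -(F_rays (y := 0)) ?lexx ?ler01// /below grid0.
by apply: cum_mono => //; apply: (measurable_preim F_cont); exact: measurable_itv.
Qed.

(** The share of the cell [i] that [F] sends into the cell [j]. *)
Definition frequency (i j : nat) : R := N.+1%:R * mass (hit j) i.

Lemma mass_ge0 A i : measurable A -> 0 <= mass A i.
Proof. by move=> mA; rewrite subr_ge0 cum_mono// grid_ge0 ler_grid leqnSn. Qed.

Lemma frequency_ge0 i j : 0 <= frequency i j.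
Proof. by rewrite mulr_ge0// mass_ge0//; exact: measurable_hit. Qed.

(** Telescoping over [j] leaves the mass of [F @^-1` `]0, 1]]; the preimage of the
    value 0 is lost, and it is a null set by invariance. *)
Lemma frequency_row (i : 'I_N.+1) : \sum_(j < N.+1) frequency i j = 1.
Proof.
rewrite /frequency -mulr_sumr /mass sumrB.
have sum_hit t : 0 <= t <= 1 -> \sum_(j < N.+1) cum (hit j) t = t.
  move=> t01; under eq_bigr do rewrite cum_hit.
  rewrite -(big_mkord xpredT (fun j => cum (below j.+1) t - cum (below j) t)).
  rewrite telescope_sumr// cum_below0// subr0.
  have -> : below N.+1 = setT.
    by apply/seteqP; split=> // x _; rewrite /below gridN /= in_itv/= F_le1.
  by rewrite cumT; case/andP: t01.
rewrite !sum_hit ?grid_ge0 ?grid_le1//; last exact: ltnW.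
by rewrite gridS addrC addKr divff.
Qed.

Lemma frequency_col (j : 'I_N.+1) : \sum_(i < N.+1) frequency i j = 1.
Proof.
rewrite /frequency -mulr_sumr sum_mass cum_hit !F_rays ?grid_ge0 ?grid_le1//;
  last exact: ltnW.
by rewrite gridS addrC addKr divff.
Qed.

Lemma frequency_gt0_point i j : 0 < frequency i j ->
  exists x, grid i <= x <= grid i.+1 /\ grid j <= F x <= grid j.+1.
Proof.
move=> h; have : 0 < mass (hit j) i by rewrite -(pmulr_rgt0 _ (ltr0Sn R N)).
rewrite /mass cumB; [|exact: measurable_hit|by rewrite grid_ge0 ler_grid /=].
have [->|/set0P[x [hx ix]]] := eqVneq (hit j `&` `]grid i, grid i.+1]) set0.
  by rewrite measure0 ltxx.
move=> _; exists x; move: hx ix; rewrite /hit /= !in_itv/= => /andP[/ltW -> ->].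
by move=> /andP[/ltW -> ->].
Qed.

Lemma frequency_gt0_interior i j c : grid i <= c <= grid i.+1 ->
  grid j < F c < grid j.+1 -> 0 < frequency i j.
Proof.
move=> /andP[ic ci] /andP[jF Fj].
have [d /= d0 dF] : exists2 d : R, 0 < d & forall x, `|c - x| < d ->
    grid j < F x < grid j.+1.
  have : \forall x \near c, grid j < F x < grid j.+1.
    near=> x; apply/andP; split.
      by near: x; apply: (cvgr_gt (F c)) => //; exact: F_cont.
    by near: x; apply: (cvgr_lt (F c)) => //; exact: F_cont.
  by move=> [d d0 dF]; exists d.
pose p := Num.max (grid i) (c - d / 2); pose q := Num.min (grid i.+1) (c + d / 2).
have d20 : 0 < d / 2 by rewrite divr_gt0.
have gi : grid i < grid i.+1 by rewrite ltr_grid.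
have pq : p < q.
  by rewrite /p /q lt_min !gt_max gi /=; apply/and3P; split; lra.
have ip : grid i <= p by rewrite /p le_max lexx.
have qi : q <= grid i.+1 by rewrite /q ge_min lexx.
have cp : c - d / 2 <= p by rewrite /p le_max lexx orbT.
have cq : q <= c + d / 2 by rewrite /q ge_min lexx orbT.
have p0 : 0 <= p by exact: le_trans (grid_ge0 i) ip.
have mh := measurable_hit j.
apply: mulr_gt0 => //; rewrite /mass.
have h1 : cum (hit j) (grid i) <= cum (hit j) p by rewrite cum_mono// grid_ge0.
have h2 : cum (hit j) q <= cum (hit j) (grid i.+1).
  by rewrite cum_mono// qi (le_trans p0)// ltW.
suff : cum (hit j) q - cum (hit j) p = q - p by lra.
rewrite cumB ?p0 ?(ltW pq)//.
rewrite (_ : hit j `&` _ = `]p, q]%classic).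
  by rewrite lebesgue_measure_itv/= lte_fin pq.
apply/setIidr => x; rewrite /hit /= !in_itv/= => /andP[px xq].
have /dF/andP[-> /ltW //] : `|c - x| < d.
by rewrite ltr_norml; apply/andP; split; lra.
Unshelve. all: by end_near. Qed.

(** The first and last cells are their own outer neighbours, which keeps the
    averaging over neighbours doubly stochastic. *)
Definition prev (i : 'I_N.+1) : 'I_N.+1 := inord i.-1.
Definition next (i : 'I_N.+1) : 'I_N.+1 := inord (minn i.+1 N).

Lemma prevE i : prev i = i.-1 :> nat.
Proof. by rewrite inordK// (leq_ltn_trans (leq_pred _)). Qed.

Lemma nextE i : next i = minn i.+1 N :> nat.
Proof. by rewrite inordK// ltnS geq_minr. Qed.

Lemma sum_prev_next (h : 'I_N.+1 -> R) :
  \sum_i h (prev i) + \sum_i h (next i) = (\sum_i h i) *+ 2.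
Proof.
have p0 : prev ord0 = ord0 by apply: ord_inj; rewrite prevE.
have nN : next ord_max = ord_max.
  by apply: ord_inj; rewrite nextE /= (minn_idPr (leqnSn _)).
have sp : \sum_(i < N) h (prev (lift ord0 i)) =
    \sum_(i < N) h (widen_ord (leqnSn N) i).
  by apply: eq_bigr => i _; congr h; apply: ord_inj; rewrite prevE.
have sn : \sum_(i < N) h (next (widen_ord (leqnSn N) i)) =
    \sum_(i < N) h (lift ord0 i).
  apply: eq_bigr => i _; congr h; apply: ord_inj.
  by rewrite nextE /= (minn_idPl (ltn_ord i)).
rewrite [\sum_i h (prev i)]big_ord_recl [\sum_i h (next i)]big_ord_recr /=.
rewrite p0 nN sp sn mulr2n {1}big_ord_recl big_ord_recr /=; ring.
Qed.

(** Two neighbouring rows of [frequency] may have disjoint supports, when [F] takes a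
    grid value at the common endpoint of their cells. After averaging, both
    rows contain a third of the same row. *)
Definition smoothed (i j : 'I_N.+1) : R :=
  (frequency (prev i) j + frequency i j + frequency (next i) j) / 3.

Lemma smoothed_ge0 i j : 0 <= smoothed i j.
Proof. by rewrite divr_ge0// !addr_ge0// frequency_ge0. Qed.

Lemma smoothed_row i : \sum_j smoothed i j = 1.
Proof. by rewrite -mulr_suml !big_split/= !frequency_row; field. Qed.

Lemma smoothed_col j : \sum_i smoothed i j = 1.
Proof.
rewrite -mulr_suml !big_split/= addrAC.
by rewrite (sum_prev_next (fun i => frequency i j)) frequency_col; field.
Qed.

Lemma smoothed_gt0 i j :
  (0 < smoothed i j) = [|| 0 < frequency (prev i) j, 0 < frequency i j |
                           0 < frequency (next i) j].
Proof.
have := frequency_ge0 (prev i) j; have := frequency_ge0 i j.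
have := frequency_ge0 (next i) j.
rewrite /smoothed pmulr_lgt0//.
move: (frequency _ _) (frequency _ _) (frequency _ _) => x y z x0 y0 z0.
by apply/idP/idP => [|/or3P[] ?]; lra.
Qed.

Lemma smoothed_adj (i i' : 'I_N.+1) : i' = i.+1 :> nat ->
  exists2 j, 0 < smoothed i j & 0 < smoothed i' j.
Proof.
move=> i'i; have [j fij] : exists j : 'I_N.+1, 0 < frequency i j.
  apply/existsP; apply: contraT; rewrite negb_exists => /forallP f0.
  have := frequency_row i; rewrite big1 => [/eqP|j _]; first by rewrite eq_sym oner_eq0.
  by apply/eqP; rewrite eq_le frequency_ge0 andbT leNgt f0.
exists j; rewrite smoothed_gt0 ?fij ?orbT//.
by rewrite prevE i'i fij.
Qed.

Lemma window_split (i : 'I_N.+1) c : grid (prev i) <= c <= grid (next i).+1 ->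
  [|| grid (prev i) <= c <= grid (prev i).+1, grid i <= c <= grid i.+1 |
      grid (next i) <= c <= grid (next i).+1].
Proof.
move=> /andP[pc cn]; rewrite pc cn andbT /=.
have [ci|ic] := leP c (grid i).
  rewrite prevE in pc *; case: (i : nat) pc ci => [|k] /= pc ci; last by rewrite ci.
  by rewrite pc (le_trans ci) ?orbT// ler_grid.
have [ci'|ci'] := leP c (grid i.+1); first by rewrite (ltW ic) orbT.
have -> : grid (next i) <= c.
  by rewrite (le_trans _ (ltW ci'))// ler_grid nextE geq_minl.
by rewrite !orbT.
Qed.

Lemma smoothed_gt0_point i j : 0 < smoothed i j ->
  exists x, grid (prev i) <= x <= grid (next i).+1 /\ grid j <= F x <= grid j.+1.
Proof.
have h1 : grid (prev i) <= grid i by rewrite ler_grid prevE leq_pred.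
have h2 : grid i <= grid (next i).
  by rewrite ler_grid nextE leq_min leqnSn -ltnS ltn_ord.
have h3 k : grid k <= grid k.+1 by rewrite ler_grid.
have h4 : grid i.+1 <= grid (next i).+1 by move: h2; rewrite !ler_grid.
have h5 : grid (prev i).+1 <= grid i.+1 by move: h1; rewrite !ler_grid.
rewrite smoothed_gt0 => /or3P[] /frequency_gt0_point[x [xi xj]]; exists x; split=> //;
  move: xi (h3 i) => /andP[? ?] ?; apply/andP; split; lra.
Qed.

(** Between two values hit from the window of [i], the intermediate value theorem
    gives a point of the window mapped inside the cell [j], and continuity gives an
    interval of such points. *)
Lemma smoothed_interval i (j1 j j2 : 'I_N.+1) : (j1 <= j <= j2)%N ->
  0 < smoothed i j1 -> 0 < smoothed i j2 -> 0 < smoothed i j.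
Proof.
move=> /andP[]; rewrite leq_eqVlt => /predU1P[/val_inj ->//|j1j].
rewrite leq_eqVlt => /predU1P[/val_inj -> //|jj2].
move=> /smoothed_gt0_point[x1 [w1 F1]] /smoothed_gt0_point[x2 [w2 F2]].
have F1' : F x1 <= grid j by case/andP: F1 => _ /le_trans; apply; rewrite ler_grid.
have F2' : grid j.+1 <= F x2 by case/andP: F2 => + _; apply: le_trans; rewrite ler_grid.
pose m := (grid j + grid j.+1) / 2.
have gS : grid j < grid j.+1 by rewrite ltr_grid.
have jm : grid j < m < grid j.+1 by rewrite /m; apply/andP; split; lra.
have [jm1 jm2] := andP jm.
have [c cw Fc] : exists2 c, grid (prev i) <= c <= grid (next i).+1 & F c = m.
  have [x12|x21] := leP x1 x2.
    have [||c cI Fc] := @IVT R F x1 x2 m x12.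
    - exact: continuous_subspaceT.
    - by rewrite ge_min le_max; apply/andP; split; apply/orP; [left|right]; lra.
    exists c => //; move: cI; rewrite in_itv/=; lra.
  have [||c cI Fc] := @IVT R F x2 x1 m (ltW x21).
  - exact: continuous_subspaceT.
  - by rewrite ge_min le_max; apply/andP; split; apply/orP; [right|left]; lra.
  exists c => //; move: cI; rewrite in_itv/=; lra.
rewrite smoothed_gt0; rewrite -Fc in jm.
by case/or3P: (window_split cw) => /frequency_gt0_interior/(_ jm) ->; rewrite ?orbT.
Qed.

End transition_matrix.

(** Heine's theorem on the unit interval. *)
Lemma uniformly_continuous01 {R : realType} (F : R -> R) (e : R) :
  continuous F -> 0 < e ->
  exists2 d, 0 < d & forall x y, 0 <= x <= 1 -> `|x - y| < d -> `|F x - F y| < e.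
Proof.
move=> cF e0.
have e20 : 0 < e / 2 by rewrite divr_gt0.
have /compact_near_coveringP cpt := @segment_compact R 0 1.
have [] := cpt _ (0 : R)^'+
  (fun d x => forall y, `|x - y| < d -> `|F x - F y| < e) _.
- move=> x _.
  have /cvgrPdist_lt/(_ _ e20)[d /= d0 dF] := cF x.
  exists (ball x (d / 2), [set d' | d' < d / 2]).
    split; first by apply: nbhsx_ballx; rewrite divr_gt0.
    by apply: nbhs_right_lt; rewrite divr_gt0.
  move=> [x' d'] [/= xx' d'd] y x'y.
  rewrite (le_lt_trans (ler_distD (F x) _ _))// (splitr e) ltrD//.
    by rewrite distrC; apply: dF => /=; apply: (lt_trans xx'); lra.
  apply: dF => /=; rewrite (le_lt_trans (ler_distD x' _ _))//.
  by rewrite (splitr d) ltrD// (lt_trans x'y).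
- move=> d /= d0 dF; exists (d / 2); first by rewrite divr_gt0.
  move=> x y x01 xy; apply: (dF (d / 2)) => //=.
  + rewrite sub0r normrN gtr0_norm; lra.
  + by rewrite divr_gt0.
Qed.

Theorem mixing_approximation {R : realType} (F : R -> R) (e : R) :
  continuous F -> (forall x, F x <= 1) ->
  (forall y, 0 <= y <= 1 -> cum (F @^-1` `]-oo, y]) 1 = y) -> 0 < e ->
  exists g : R -> R, [/\ continuous g,
    forall t, 0 <= t <= 1 -> 0 <= g t <= 1,
    forall A, (@measurable _ (measurableTypeR R)) A -> cum (g @^-1` A) 1 = cum A 1,
    forall A B, (@measurable _ (measurableTypeR R)) A ->
      (@measurable _ (measurableTypeR R)) B -> mixes g A B &
    forall t, 0 <= t <= 1 -> `|F t - g t| <= e].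
Proof.
move=> cF F1 FR e0.
have e20 : 0 < e / 2 by rewrite divr_gt0.
have [d d0 dF] := uniformly_continuous01 cF e20.
(* A point of the window of the cell of [t] is within two cell lengths of [t], and a
   value in a cell is within one cell length of its endpoints. *)
pose m := Num.min (d / 4) (e / 2).
have m0 : 0 < m by rewrite lt_min; apply/andP; split; lra.
have [N [N_gt0 Nm]] : exists N, (0 < N)%N /\ N.+1%:R^-1 < m.
  have [N _ NP] := near_infty_natSinv_lt (PosNum m0).
  by exists N.+1; split=> //; exact: (NP N.+1 (leqnSn _)).
have [h1 h2] : N.+1%:R^-1 < d / 4 /\ N.+1%:R^-1 < e / 2.
  by move: Nm; rewrite lt_min => /andP.
have [g [cg g01 gP gmix gclose]] := @markov_map_exists R N (smoothed F) N_gt0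
  (smoothed_ge0 cF) (smoothed_row cF F1 FR) (smoothed_col cF FR)
  (smoothed_adj cF F1 FR) (smoothed_interval cF).
exists g; split=> // t t01; have [i it ti] := @cell_of _ N t t01.
have [j1 [j2 [P1 P2 gt]]] := gclose i t (introT andP (conj it ti)).
have [F1' F2'] : F t <= g t + e /\ g t - e <= F t.
  have gS k : @grid R N k.+1 = @grid R N k + N.+1%:R^-1 by exact: gridS.
  have window x : @grid R N (prev i) <= x <= @grid R N (next i).+1 -> `|t - x| < d.
    move=> /andP[px xn].
    have p1 : @grid R N i <= @grid R N (prev i) + N.+1%:R^-1.
      by rewrite -gS ler_grid prevE leqSpred.
    have n1 : @grid R N (next i).+1 <= @grid R N i.+1 + N.+1%:R^-1.
      by rewrite -gS ler_grid nextE ltnS geq_minl.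
    have := gS i; move: (N.+1%:R^-1) h1 p1 n1 => s h1 p1 n1 gi.
    by rewrite ltr_norml; apply/andP; split; lra.
  move: gt => /andP[jg gj].
  have [x1 [/window/(dF _ _ t01) Fx1 /andP[_ Fj1]]] := smoothed_gt0_point cF P1.
  have [x2 [/window/(dF _ _ t01) Fx2 /andP[Fj2 _]]] := smoothed_gt0_point cF P2.
  move: Fx1 Fx2; rewrite !ltr_norml => /andP[_ b1] /andP[b2 _].
  move: Fj1 gj; rewrite !gS; move: (N.+1%:R^-1) h2 => s h2 Fj1 gj.
  by split; lra.
by rewrite ler_norml; apply/andP; split; lra.
Qed.

(** * Maps of the unit interval as maps of the line *)

Section unit_interval.
Context {R : realType}.
Local Notation mu := (@lebesgue_measure R).
Local Notation measurable := (@measurable _ (measurableTypeR R)).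
Implicit Types (X Y : set R) (f : Clambda R).

Lemma clamp_subproof (x : R) : Num.max 0 (Num.min 1 x) \in `[(0 : R), 1]%classic.
Proof.
by apply/mem_set; rewrite /= in_itv/= le_max lexx/= ge_max ler01 ge_min lexx.
Qed.

Definition clamp (x : R) : I01 R := 
  exist (fun y => y \in `[(0 : R), 1]%classic) _ (clamp_subproof x).

Lemma val_clamp x : 0 <= x <= 1 -> set_val (clamp x) = x.
Proof. by move=> /andP[x0 x1]; rewrite set_valE /= min_r// max_r. Qed.

Lemma clampK (y : I01 R) : clamp (set_val y) = y.
Proof. by apply: val_inj; apply: val_clamp; exact: I01_bounds. Qed.

Lemma set_val_continuous : continuous (set_val : I01 R -> R).
Proof. exact: initial_continuous. Qed.

Lemma clamp_continuous : continuous clamp.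
Proof.
apply: continuous_comp_initial => x.
apply: (@continuous_max R R (cst 0) (fun s => Num.min 1 s)); first exact: cvg_cst.
by apply: (@continuous_min R R (cst 1) id); [exact: cvg_cst|exact: cvg_id].
Qed.

Lemma lambda01_preimage X : measurable X ->
  lambda01 (set_val @^-1` X : set (I01 R)) = (cum X 1)%:E.
Proof.
move=> mX; rewrite /cum fineK ?mu_itv_fin// /lambda01.
have -> : set_val @` (set_val @^-1` X : set (I01 R)) = X `&` `[0, 1].
  apply/seteqP; split=> [_ [y Xy <-]|x [Xx]].
    by split=> //=; rewrite in_itv/=; exact: I01_bounds.
  by rewrite /= in_itv/= => x01; exists (clamp x); rewrite ?val_clamp//= val_clamp.
apply: (@lebesgue_measure_off_null _ _ _ [set 0]).
- exact: measurableI.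
- exact: measurableI.
- exact: measurable_set1.
- exact: lebesgue_measure_set1.
- move=> x [Xx]; rewrite /= !in_itv/= => /andP[].
  rewrite le_eqVlt => /predU1P[<-|x0 x1]; first by right.
  by left; rewrite x0 x1.
- by move=> x [Xx]; rewrite /= !in_itv/= => /andP[/ltW -> ->]; left.
Qed.

Lemma borel01_closed X : closed X -> borel01 (set_val @^-1` X : set (I01 R)).
Proof.
move=> cX; rewrite -[_ @^-1` _]setCK -setTD.
have [_ sC _] := @smallest_sigma_algebra _ [set: I01 R] [set U : set (I01 R) | open U].
apply: sC; apply: sub_sigma_algebra => /=.
rewrite preimage_setC; apply: open_comp; last exact: closed_openC.
by move=> y _; exact: set_val_continuous.
Qed.

Lemma borel01_preimage (A : set (I01 R)) : borel01 A ->
  exists2 X, measurable X & A = set_val @^-1` X.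
Proof.
move: A; apply: smallest_sub => /=.
  split.
  - by exists set0.
  - move=> _ [X mX ->]; exists (~` X); first exact: measurableC.
    by rewrite setTD preimage_setC.
  - move=> A AX; have /choice[X XP] : forall n, exists X,
        measurable X /\ A n = set_val @^-1` X.
      by move=> n; have [X mX AE] := AX n; exists X.
    exists (\bigcup_n X n); first by apply: bigcupT_measurable => n; case: (XP n).
    by rewrite preimage_bigcup; apply: eq_bigcupr => n _; case: (XP n).
move=> U [V oV <-]; exists V => //; exact: open_measurable.
Qed.

Definition extend f : R -> R := fun x => set_val (f (clamp x)).

Lemma extend_continuous f : continuous (extend f).
Proof.
move=> x; apply: (@continuous_comp _ _ _ (f \o clamp) set_val).
  apply: continuous_comp; first exact: clamp_continuous.
  exact: Clambda_continuous.
exact: set_val_continuous.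
Qed.

Lemma extend_le1 f x : extend f x <= 1.
Proof. by case/andP: (I01_bounds (f (clamp x))). Qed.

Lemma extend_rays f y : 0 <= y <= 1 -> cum (extend f @^-1` `]-oo, y]) 1 = y.
Proof.
move=> /andP[y0 y1]; apply: EFin_inj.
rewrite -lambda01_preimage; last first.
  by apply: (measurable_preim (@extend_continuous f)); exact: measurable_itv.
have -> : (set_val @^-1` (extend f @^-1` `]-oo, y]) : set (I01 R)) =
    f @^-1` (set_val @^-1` `]-oo, y]).
  by apply/funext => x; rewrite /preimage/= /extend clampK.
rewrite -Clambda_preserving; last first.
  by apply: borel01_closed; rewrite set_itvE; exact: closed_le.
rewrite lambda01_preimage; last exact: measurable_itv.
rewrite /cum (_ : _ `&` _ = `]0, y]%classic).
  by rewrite -[X in _ = X%:E](cumT y0) /cum setTI.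
by apply/seteqP; split => x /=; rewrite !in_itv/=; lra.
Qed.

Section restriction.
Variable g : R -> R.
Hypothesis g_cont : continuous g.
Hypothesis g01 : forall t, 0 <= t <= 1 -> 0 <= g t <= 1.
Hypothesis g_pres : forall A, measurable A -> cum (g @^-1` A) 1 = cum A 1.

Definition restrict (x : I01 R) : I01 R := clamp (g (set_val x)).

Lemma val_restrict x : set_val (restrict x) = g (set_val x).
Proof. by rewrite val_clamp// g01// I01_bounds. Qed.

Lemma restrict_continuous : continuous restrict.
Proof.
move=> x; apply: (@continuous_comp _ _ _ (g \o set_val) clamp).
  apply: continuous_comp; first exact: set_val_continuous.
  exact: g_cont.
exact: clamp_continuous.
Qed.

Lemma restrict_preserving A : borel01 A ->
  lambda01 A = lambda01 (restrict @^-1` A).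
Proof.
move=> /borel01_preimage[X mX ->].
rewrite lambda01_preimage// -g_pres// -lambda01_preimage; last first.
  exact: measurable_preim.
by congr lambda01; apply/funext => x; rewrite /preimage/= val_restrict.
Qed.

Definition Clambda_restrict : Clambda R :=
  MkClambda restrict_continuous restrict_preserving.

Lemma restrict_mixing :
  (forall A B, measurable A -> measurable B -> mixes g A B) ->
  strongly_mixing Clambda_restrict.
Proof.
move=> gmix _ _ /borel01_preimage[X mX ->] /borel01_preimage[Y mY ->].
have val_iter n x : set_val (iter n restrict x) = iter n g (set_val x).
  by elim: n => //= n IHn; rewrite val_restrict IHn.
have mXn n : measurable (iter n g @^-1` X) by exact: measurable_iter.
rewrite !lambda01_preimage// -EFinM.
rewrite (_ : (fun n => _) = EFin \o (fun n => cum (iter n g @^-1` X `&` Y) 1)).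
  by apply: cvg_EFin; [exact: nearW|exact: gmix].
apply/funext => n /=; rewrite -lambda01_preimage; last exact: measurableI.
by congr lambda01; apply/funext => x; rewrite /preimage/= val_iter.
Qed.

End restriction.

End unit_interval.

Theorem corollary14 (R : realType) : dense (Clambda_smix R).
Proof.
move=> O [f Of] oO.
have /nbhs_ballP[e /= e0 feO] : nbhs f O by apply: open_nbhs_nbhs.
have e20 : 0 < e / 2 by rewrite divr_gt0.
have [g [cg g01 gP gmix gclose]] := mixing_approximation
  (extend_continuous (f := f)) (extend_le1 f) (extend_rays f) e20.
exists (Clambda_restrict cg g01 gP); split; last exact: restrict_mixing.
apply: feO; rewrite /ball/=.
apply: (@le_lt_trans _ _ (e / 2)); last by lra.
apply: rho_le => x; rewrite val_restrict//.
by have := gclose _ (I01_bounds x); rewrite /extend clampK.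
Qed.
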